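(* Let $G$ be a connected, planar, directed, acyclic graph with $n$ left endpoints and $n$ right endpoints, all lying on the outside face, with edge weights in a commutative ring $R$ with unit (all weights equal to $1$ in the unweighted case). Suppose that the left endpoints are segregated from the right endpoints on the outside face. Let $V$ be the Gessel-Viennot matrix of $G$ and let $G'$ be the transit-free resolution of $G$. (1) If the left endpoints are the sources of $G$ and the right endpoints are the sinks of $G$, then $V$ is obtained from a Kasteleyn-Percus matrix $M$ of $G'$ by deleted pivots. (2) If not every left endpoint is a source or not every right endpoint is a sink, then $V$ is obtained from a Kasteleyn-Percus matrix $M$ of $G'$ by deleted pivots and other matrix operations.
   Context: Graphs are finite and may have multiple edges. A planar graph is a graph embedded in the sphere with one marked point off the graph; the face containing it is the outside (infinite) face, the other faces are the finite faces. Endpoints: some vertices of $G$ are labelled as left endpoints ($n$ of them) and some as right endpoints ($n$ of them), and the left endpoints and the right endpoints are separately ordered. A vertex is allowed to be both a left endpoint and a right endpoint. ''Segregated'' means that, in the cyclic order around the outside face, all left endpoints are consecutive and all right endpoints are consecutive (a vertex that is both is counted once as each). A source is a vertex of in-degree $0$, a sink is a vertex of out-degree $0$, and a transit vertex is a vertex which is neither. Gessel-Viennot matrix: $V$ is the $n\times n$ matrix whose entry $V_{i,j}$ is the total weight of all directed paths in $G$ from left endpoint $i$ to right endpoint $j$, where the weight of a path is the product of the weights of its edges (so $V_{i,j}$ is the number of such paths in the unweighted case). A path of length zero, from a vertex to itself, counts and has weight $1$. Transit-free resolution $G'$: First remove every edge that points into a left endpoint and every edge that points out of a right endpoint; then repeatedly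 delete every source or sink that is not an endpoint. (When the left endpoints are the sources and the right endpoints are the sinks, these steps do nothing.) Then replace each remaining transit vertex $p$ by two vertices $q$ and $r$, where $q$ receives all the edges pointing into $p$ and $r$ emits all the edges pointing out of $p$, and add a new edge from $r$ to $q$. The planar embedding of $G'$ is inherited from $G$ by carrying out each splitting in a small neighborhood of $p$. In the degenerate case of a vertex that is both a left and a right endpoint, that vertex has become isolated; it is regarded as a left endpoint and a right endpoint joined by a single edge of weight $1$ (omitting this pair changes $M$ below only by the inverse of the stabilization $M\mapsto\begin{pmatrix}1&0\\0&M\end{pmatrix}$, up to sign). The graph $G'$ is bipartite: the left endpoints and the vertices $r$ are black, the right endpoints and the vertices $q$ are white. Old edges of $G'$ keep their weights, and new edges have weight $1$ before signs are assigned. Kasteleyn-Percus matrix: for a weighted bipartite planar graph, assign a sign $+$ or $-$ to each edge so that the boundary of each finite face has an odd number of $-$ signs if and only if its number of sides is divisible by $4$ (edges counted with multiplicity along the face boundary). A Kasteleyn-Percus matrix $M$ is the corresponding bipartite adjacency matrix: rows are indexed by the black vertices, columns by the white vertices (in any order), and $M_{i,j}$ is the sum, over all edges joining black vertex $i$ to white vertex $j$, of the sign of the edge times its weight. Matrix operations: a general row (resp. column) operation is $M\mapsto AM$ (resp. $M\mapsto MA$) with $A$ invertible over $R$. A pivot on $M$ at position $(i,j)$, possible when $M_{i,j}$ divides all entries in its row and column, subtracts $M_{k,j}/M_{i,j}$ times row $i$ from row $k$ for all $k\neq i$ and then subtracts $M_{i,k}/M_{i,j}$ times column $j$ from column $k$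 for all $k\ne j$. A deleted pivot at $(i,j)$ is a pivot at $(i,j)$ followed by deleting row $i$ and column $j$. ''Other matrix operations'' in (2) are general row and column operations. *)

(* Defs.v *)
From HB Require Import structures.
From mathcomp Require Import all_boot all_order all_fingroup all_algebra.

Set Implicit Arguments.
Unset Strict Implicit.
Unset Printing Implicit Defensive.

Import GRing.Theory.

(* A directed multigraph with the data of a cellular embedding.  A dart is an
   edge with a choice of end: (e, true) is e seen from its source, (e, false)
   is e seen from its target.  [rot] sends a dart to the next dart clockwise
   around the same vertex; [outer] is the marked face, as a set of darts. *)
Record embedded_digraph := EmbeddedDigraph {
  vertex : finType;
  edge : finType;
  src : edge -> vertex;
  dst : edge -> vertex;
  rot : {perm edge * bool};
  outer : {set edge * bool}
}.

Definition dart (G : embedded_digraph) : finType := (edge G * bool)%type.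

Definition base (G : embedded_digraph) (d : dart G) : vertex G :=
  if d.2 then src d.1 else dst d.1.

Definition rev (G : embedded_digraph) (d : dart G) : dart G := (d.1, ~~ d.2).

(* Walk along d, then leave by the next dart clockwise: this follows the
   boundary of the face lying to the left of d. *)
Definition face_next (G : embedded_digraph) (d : dart G) : dart G :=
  rot G (rev d).

Definition left_face (G : embedded_digraph) (d : dart G) : {set dart G} :=
  [set d' | fconnect (@face_next G) d d'].

Definition faces (G : embedded_digraph) : {set {set dart G}} :=
  [set left_face d | d : dart G].

Definition adjacent (G : embedded_digraph) : rel (vertex G) := fun u v =>
  [exists e : edge G,
     ((src e == u) && (dst e == v)) || ((src e == v) && (dst e == u))].

Definition connected_graph (G : embedded_digraph) : Prop :=
  forall u v : vertex G, connect (@adjacent G) u v.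

(* For a connected G: the cyclic orders given by [rot] are those of the darts
   around each vertex, the surface they define is the sphere (Euler's formula),
   and the marked face is one of the faces.  A graph without edges has one face,
   which carries no dart; this is the reason for [maxn]. *)
Definition planar_embedding (G : embedded_digraph) : Prop :=
  [/\ forall d d' : dart G, (d' \in porbit (rot G) d) = (base d' == base d),
      #|vertex G| + maxn 1 #|faces G| = #|edge G| + 2
    & outer G \in faces G \/ #|edge G| = 0].

Fixpoint dipath (G : embedded_digraph) (u v : vertex G) (p : seq (edge G)) :
    bool :=
  if p is e :: p' then (src e == u) && dipath (dst e) v p' else u == v.

Definition acyclic (G : embedded_digraph) : Prop :=
  forall (v : vertex G) (p : seq (edge G)), dipath v v p -> p = [::].

Definition is_source (G : embedded_digraph) (v : vertex G) : bool :=
  [forall e : edge G, dst e != v].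

Definition is_sink (G : embedded_digraph) (v : vertex G) : bool :=
  [forall e : edge G, src e != v].

(* The vertices met along the outside face, as a cyclic sequence cut at an
   arbitrary place; a cut vertex may occur several times. *)
Definition outer_walk (G : embedded_digraph) (s : seq (vertex G)) : Prop :=
  (exists2 d : dart G, d \in outer G &
     s = [seq base x | x <- fingraph.orbit (@face_next G) d])
  \/ (#|edge G| = 0 /\ s = enum (vertex G)).

Definition on_outside (G : embedded_digraph) (v : vertex G) : Prop :=
  exists2 s, outer_walk s & v \in s.

(* The closed walk s_0, ..., s_(N-1), s_0 around the outside face is cut at some
   position k into two arcs, one having an occurrence of every left endpoint and
   the other an occurrence of every right endpoint.  The arcs share their two
   extremities, where a vertex which is both left and right may lie. *)
Definition segregated (G : embedded_digraph) (n : nat)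
    (lend rend : 'I_n -> vertex G) : Prop :=
  exists (s : seq (vertex G)) (k : nat),
    [/\ outer_walk s,
        forall i, lend i \in take k.+1 s
      & forall j, rend j \in drop k (s ++ take 1 s)].

(* In an acyclic graph every directed path has fewer edges than there are
   vertices, so the sum below is over all directed paths. *)
Definition gessel_viennot (R : comPzRingType) (G : embedded_digraph)
    (w : edge G -> R) (n : nat) (lend rend : 'I_n -> vertex G) : 'M[R]_n :=
  (\matrix_(i < n, j < n)
     \sum_(l < #|vertex G|)
       \sum_(p : l.-tuple (edge G) | dipath (lend i) (rend j) p)
         \prod_(e <- p) w e)%R.

(* [L] and [T] are the sets of left and of right endpoints. *)
Definition kept (G : embedded_digraph) (L T : {set vertex G}) (e : edge G) :
    bool :=
  (dst e \notin L) && (src e \notin T).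

Definition prune (G : embedded_digraph) (L T S : {set vertex G}) :
    {set vertex G} :=
  [set v in S | (v \in L :|: T) ||
     ([exists e, [&& kept L T e, dst e == v & src e \in S]] &&
      [exists e, [&& kept L T e, src e == v & dst e \in S]])].

(* #|vertex G| rounds of deletion are enough to stabilize, see [prune_alive]. *)
Definition alive (G : embedded_digraph) (L T : {set vertex G}) :
    {set vertex G} :=
  iter #|vertex G| (prune L T) setT.

Definition live (G : embedded_digraph) (L T : {set vertex G}) :
    {set edge G} :=
  [set e | [&& kept L T e, src e \in alive L T & dst e \in alive L T]].

Definition transit (G : embedded_digraph) (L T : {set vertex G}) :
    {set vertex G} :=
  [set v in alive L T | [exists e in live L T, dst e == v] &&
                        [exists e in live L T, src e == v]].

Lemma prune_alive (G : embedded_digraph) (L T : {set vertex G}) :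
  prune L T (alive L T) = alive L T.
Proof.
pose F k := iter k (prune L T) setT.
have subF S : prune L T S \subset S.
  by apply/subsetP=> v; rewrite inE => /andP[].
suff H k : prune L T (F k) = F k \/ #|F k| + k <= #|vertex G|.
  case: (H #|vertex G|) => // le0; have F0 : F #|vertex G| = set0.
    by apply/eqP; rewrite -cards_eq0 -leqn0 -(leq_add2r #|vertex G|) add0n.
  by rewrite /alive -/(F _) F0; apply/eqP; rewrite -subset0 subF.
elim: k => [|k [IH|IH]]; first by right; rewrite addn0 max_card.
  by left; rewrite /F iterS -/(F k) IH.
have [E|ne] := eqVneq (prune L T (F k)) (F k).
  by left; rewrite /F iterS -/(F k) E.
right; rewrite addnS -addSn; apply: leq_trans IH; rewrite leq_add2r /F iterS.
by apply: proper_card; rewrite properEneq ne subF.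
Qed.

(* The vertex set of the resolution: a transit vertex p stands for r among the
   black vertices and for q among the white ones. *)
Definition black_set (G : embedded_digraph) (L T : {set vertex G}) :=
  L :|: transit L T.
Definition white_set (G : embedded_digraph) (L T : {set vertex G}) :=
  T :|: transit L T.

Lemma live_ends (G : embedded_digraph) (L T : {set vertex G}) (e : edge G) :
  e \in live L T -> src e \in black_set L T /\ dst e \in white_set L T.
Proof.
move=> le; have := le; rewrite inE => /and3P[ke sa da]; have := ke.
rewrite /kept => /andP[dL sT]; split; rewrite !inE.
- case: (boolP (src e \in L)) => //= sL; rewrite sa /=.
  have := sa; rewrite -prune_alive inE inE (negPf sL) (negPf sT) /= sa /=.
  case/andP=> /existsP[f /and3P[kf /eqP df sf]] _; apply/andP; split.
    by apply/existsP; exists f; rewrite inE kf sf df sa eqxx.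
  by apply/existsP; exists e; rewrite le eqxx.
- case: (boolP (dst e \in T)) => //= dT; rewrite da /=.
  have := da; rewrite -prune_alive inE inE (negPf dL) (negPf dT) /= da /=.
  case/andP=> _ /existsP[f /and3P[kf /eqP sf df]]; apply/andP; split.
    by apply/existsP; exists e; rewrite le eqxx.
  by apply/existsP; exists f; rewrite inE kf sf df da eqxx.
Qed.

(* A weighted bipartite plane graph, with as much of its embedding as the sign
   rule depends on: the faces on the two sides of each edge.  [bg_face (e, true)]
   is to the left of e traversed from black to white, [bg_face (e, false)] to
   the left of e traversed from white to black.  The graph may be
   disconnected. *)
Record plane_bigraph (R : Type) := PlaneBigraph {
  bg_black : finType;
  bg_white : finType;
  bg_edge : finType;
  bg_faces : finType;
  bg_bend : bg_edge -> bg_black;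
  bg_wend : bg_edge -> bg_white;
  bg_weight : bg_edge -> R;
  bg_face : bg_edge * bool -> bg_faces;
  bg_outer : bg_faces
}.

(* Deleting an edge merges the faces on its two sides. *)
Definition merge (G : embedded_digraph) (L T : {set vertex G}) :
    rel {set dart G} := fun f f' =>
  [exists d : dart G,
     [&& d.1 \notin live L T, left_face d == f & left_face (rev d) == f']].

Definition merged_face (G : embedded_digraph) (L T : {set vertex G})
    (f : {set dart G}) : {set {set dart G}} :=
  [set f' | connect (merge L T) f f'].

(* The next dart clockwise around the same vertex, among those of the edges
   which are not deleted (and d itself if there is no other). *)
Definition live_next (G : embedded_digraph) (L T : {set vertex G})
    (d : dart G) : dart G :=
  head d [seq x <- traject (rot G) (rot G d) #|dart G| | x.1 \in live L T].

(* The face to the left of the new edge at v, traversed from black to white if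
   b and from white to black if not.  If v is a transit vertex p, split into r
   (with the outgoing darts) and q (with the incoming darts), the new edge from
   r to q has on its left the corner of p where, clockwise, an outgoing dart is
   followed by an incoming one, and on its right the corner where an incoming
   dart is followed by an outgoing one.  There is one corner of each kind when
   the incoming edges are consecutive around p, i.e. when p can be split in the
   plane; otherwise the choice made here is meaningless.  If v is both a left
   and a right endpoint then it carries no dart any more and lies on the outside
   face. *)
Definition new_face (G : embedded_digraph) (L T : {set vertex G})
    (v : vertex G) (b : bool) : {set {set dart G}} :=
  if [pick x : dart G | [&& x.1 \in live L T, base x == v, x.2 == b
                          & (live_next L T x).2 == ~~ b]] is Some x
  then merged_face L T (left_face (live_next L T x))
  else merged_face L T (outer G).

(* The edges are the surviving edges of G, and one new edge for each vertex of G
   which stands both for a black and for a white vertex, that is, for each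
   transit vertex and for each vertex which is both a left and a right
   endpoint. *)
Definition resolution (R : comPzRingType) (G : embedded_digraph)
    (w : edge G -> R) (L T : {set vertex G}) : plane_bigraph R :=
  let B := black_set L T in
  let W := white_set L T in
  @PlaneBigraph R
    {v : vertex G | v \in B}
    {v : vertex G | v \in W}
    ({e : edge G | e \in live L T} + {v : vertex G | (v \in B) && (v \in W)})%type
    {set {set dart G}}
    (fun e => match e with
       | inl a => exist (fun v => v \in B) (src (sval a))
                        (proj1 (live_ends (svalP a)))
       | inr p => exist (fun v => v \in B) (sval p) (proj1 (andP (svalP p)))
       end)
    (fun e => match e with
       | inl a => exist (fun v => v \in W) (dst (sval a))
                        (proj2 (live_ends (svalP a)))
       | inr p => exist (fun v => v \in W) (sval p) (proj2 (andP (svalP p)))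
       end)
    (fun e => match e with inl a => w (sval a) | inr _ => 1%R end)
    (fun d => match d.1 with
       | inl a => merged_face L T (left_face ((sval a, d.2) : dart G))
       | inr p => new_face L T (sval p) d.2
       end)
    (merged_face L T (outer G)).

Definition transit_free_resolution (R : comPzRingType) (G : embedded_digraph)
    (w : edge G -> R) (n : nat) (lend rend : 'I_n -> vertex G) :
    plane_bigraph R :=
  resolution w [set lend i | i : 'I_n] [set rend j | j : 'I_n].

(* [sgn e = true] means that e has the sign -.  An edge with the same face on
   both sides is counted twice in the boundary of that face. *)
Definition kasteleyn_signs (R : Type) (X : plane_bigraph R)
    (sgn : bg_edge X -> bool) : Prop :=
  forall d0 : bg_edge X * bool, bg_face d0 <> bg_outer X ->
    odd #|[set d : bg_edge X * bool | (bg_face d == bg_face d0) && sgn d.1]|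
    <-> 4 %| #|[set d : bg_edge X * bool | bg_face d == bg_face d0]|.

Definition kasteleyn_percus (R : comPzRingType) (X : plane_bigraph R)
    (M : 'M[R]_(#|bg_black X|, #|bg_white X|)) : Prop :=
  exists (rho : 'I_#|bg_black X| -> bg_black X)
         (gam : 'I_#|bg_white X| -> bg_white X)
         (sgn : bg_edge X -> bool),
    [/\ bijective rho, bijective gam, kasteleyn_signs sgn
      & M = (\matrix_(i, j)
               \sum_(e : bg_edge X | (bg_bend e == rho i) && (bg_wend e == gam j))
                  (-1) ^+ sgn e * bg_weight e)%R].

(* [c k] is the quotient M k j / M i j and [r l] the quotient M i l / M i j. *)
Definition pivot (R : comPzRingType) (p q : nat) (i : 'I_p) (j : 'I_q)
    (M M' : 'M[R]_(p, q)) : Prop :=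
  exists (c : 'I_p -> R) (r : 'I_q -> R),
    [/\ forall k, (M k j = c k * M i j)%R,
        forall l, (M i l = r l * M i j)%R
      & let M1 := (\matrix_(k, l)
                     if k == i then M k l else M k l - c k * M i l)%R in
        M' = (\matrix_(k, l)
                if l == j then M1 k l else M1 k l - r l * M1 k j)%R].

(* V is obtained from the last argument by a sequence of deleted pivots. *)
Inductive by_deleted_pivots (R : comPzRingType) (m n : nat) (V : 'M[R]_(m, n)) :
    forall p q : nat, 'M[R]_(p, q) -> Prop :=
| dp_done : by_deleted_pivots V V
| dp_pivot (p q : nat) (M M' : 'M[R]_(p, q)) (i : 'I_p) (j : 'I_q) :
    pivot i j M M' -> by_deleted_pivots V (row' i (col' j M')) ->
    by_deleted_pivots V M.

(* The same with general row and column operations allowed as well. *)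
Inductive by_matrix_operations (R : comPzRingType) (m n : nat)
    (V : 'M[R]_(m, n)) : forall p q : nat, 'M[R]_(p, q) -> Prop :=
| mo_done : by_matrix_operations V V
| mo_pivot (p q : nat) (M M' : 'M[R]_(p, q)) (i : 'I_p) (j : 'I_q) :
    pivot i j M M' -> by_matrix_operations V (row' i (col' j M')) ->
    by_matrix_operations V M
| mo_row (p q : nat) (M : 'M[R]_(p, q)) (A A' : 'M[R]_p) :
    (A *m A' = 1%:M)%R -> (A' *m A = 1%:M)%R ->
    by_matrix_operations V (A *m M)%R -> by_matrix_operations V M
| mo_col (p q : nat) (M : 'M[R]_(p, q)) (A A' : 'M[R]_q) :
    (A *m A' = 1%:M)%R -> (A' *m A = 1%:M)%R ->
    by_matrix_operations V (M *m A)%R -> by_matrix_operations V M.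

(* Main.v *)
(** Give the sign - to the new edge of each transit vertex and + to all the
other edges.  Pivoting on a new edge then turns "enter p, leave p" into a
product of weights, so that eliminating the transit vertices leaves the path
sums between the endpoints which avoid other endpoints; cutting a path of G at
its last left endpoint, then at the first right endpoint which follows, compares
these sums with V up to two invertible factors.

That the signs are Kasteleyn amounts to two facts on the live edges: around a
transit vertex the incoming edges are consecutive, and the boundary of a finite
face turns exactly twice (it has one source and one sink).  Add a hub in the
outside face, with edges to the left endpoints and from the right endpoints.
Each corner is either a passage between an incoming and an outgoing edge or a
turn of its face; counting corners, Euler's formula says that
sum_v (1 - p v) + sum_c (1 - t c) >= 2, where p v counts the passages from out
to in at v and t c the source turns of the face c.  Each vertex has p >= 1; a
face with t = 0 contains a directed closed walk, hence a passage at the hub,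
and segregation leaves only two of these.  So all inequalities are tight. *)

From mathcomp Require Import all_boot all_order all_fingroup all_algebra zify.
Require Import Defs.

Set Implicit Arguments.
Unset Strict Implicit.
Unset Printing Implicit Defensive.

Import GRing.Theory.

(** * Deleting edges from a map *)

Definition flip (E : Type) (d : E * bool) : E * bool := (d.1, ~~ d.2).

Lemma flipK (E : Type) : involutive (@flip E).
Proof. by case=> e b; rewrite /flip /= negbK. Qed.

Section Classes.
Variables (T I : finType) (g : I * bool -> T).
Implicit Types S : {set I}.

(** One relation serves twice: with [g] the base vertex it generates the components of the subgraph
    [S], with [g] the left face it merges the faces across the edges of [S]. *)
Definition link S : rel T := fun x y =>
  [exists d : I * bool, [&& d.1 \in S, g d == x & g (flip d) == y]].

Definition link_class S x := [set y | connect (link S) x y].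
Definition link_classes S := [set link_class S x | x : T].

Lemma link_sym S : symmetric (link S).
Proof.
move=> x y; apply/existsP/existsP=> -[d /and3P[dS dx dy]];
  by exists (flip d); rewrite dS flipK dx dy.
Qed.

Lemma connect_link_sym S : connect_sym (link S).
Proof. exact/sym_connect_sym/link_sym. Qed.

Lemma linkI S d : d.1 \in S -> link S (g d) (g (flip d)).
Proof. by move=> dS; apply/existsP; exists d; rewrite dS !eqxx. Qed.

Lemma class_refl S x : x \in link_class S x.
Proof. by rewrite inE connect0. Qed.

Lemma class_eqP S x y : reflect (link_class S x = link_class S y)
  (connect (link S) x y).
Proof.
apply: (iffP idP) => [xy|E].
  by apply/setP=> z; rewrite !inE (same_connect (@connect_link_sym S) xy).
by have := class_refl S y; rewrite -E inE.
Qed.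

Lemma class_link S d : d.1 \in S -> link_class S (g d) =
  link_class S (g (flip d)).
Proof. by move=> dS; apply/class_eqP/connect1/linkI. Qed.

Lemma mem_classes S x : link_class S x \in link_classes S.
Proof. exact: imset_f. Qed.

Lemma sub_connect_link S S' : S \subset S' ->
  subrel (connect (link S)) (connect (link S')).
Proof.
move=> /subsetP sS; apply: connect_sub => x y /existsP[d /and3P[dS dx dy]].
by apply: connect1; apply/existsP; exists d; rewrite sS // dx dy.
Qed.

Lemma connect_link_setU1 S i x y : connect (link (i |: S)) x y ->
  connect (link S) x y \/
  (forall z, z \in [set x; y] ->
     z \in link_class S (g (i, true)) :|: link_class S (g (i, false))).
Proof.
case/connectP=> p; elim: p x => [|z p IH] x /=.
  by move=> _ ->; left; rewrite connect0.
case/andP=> /existsP[d /and3P[]]; rewrite in_setU1 => /orP[/eqP di|dS] dx dz.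
- move=> pz /(IH _ pz) E; right.
  have xi : x \in link_class S (g (i, true)) :|: link_class S (g (i, false)).
    rewrite -(eqP dx) [d]surjective_pairing di.
    by case: d.2; rewrite inE class_refl ?orbT.
  have zi : z \in link_class S (g (i, true)) :|: link_class S (g (i, false)).
    rewrite -(eqP dz) /flip di.
    by case: d.2; rewrite inE class_refl ?orbT.
  move=> t; rewrite !inE => /orP[/eqP->|/eqP->]; first by move: xi;
    rewrite !inE.
  case: E => [zy|/(_ y)]; last by rewrite !inE eqxx orbT => /(_ isT).
  by move: zi; rewrite !inE => /orP[|] /connect_trans ->; rewrite ?orbT.
move=> pz /(IH _ pz) E.
have xz : connect (link S) x z.
  by rewrite -(eqP dx) -(eqP dz); apply/connect1/linkI.
case: E => [zy|E]; [left; exact: connect_trans zy|right=> t].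
have /E zi : z \in [set z; y] by rewrite !inE eqxx.
rewrite !inE => /orP[/eqP->|/eqP->]; last first.
  by have /E : y \in [set z; y]; rewrite !inE ?eqxx ?orbT.
rewrite connect_link_sym in xz.
by move: zi; rewrite !inE => /orP[|] /connect_trans ->; rewrite ?orbT.
Qed.

(** Adding [i] can only merge the classes of its two ends. [G] sends a class of [S] to the class of
    [i |: S] around it; it is injective once the class [b] of one end is set aside, and injective
    outright when both ends share a class. *)
Lemma card_classes_setU1 S i :
  #|link_classes S| <= #|link_classes (i |: S)| + 1 /\
  (connect (link S) (g (i, true)) (g (i, false)) ->
     #|link_classes S| <= #|link_classes (i |: S)|).
Proof.
pose b := link_class S (g (i, false)).
pose G (X : {set T}) := [set y | [exists x in X, connect (link (i |: S)) x y]].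
have GE x : G (link_class S x) = link_class (i |: S) x.
  apply/setP=> y; rewrite !inE; apply/exists_inP/idP => [[z]|xy].
    rewrite inE => /(sub_connect_link (subsetUr [set i] S)); exact:
      connect_trans.
  by exists x; rewrite ?class_refl.
have imG (X : {set {set T}}) : X \subset link_classes S -> #|G @: X| <=
  #|link_classes (i |: S)|.
  move=> sX; apply/subset_leq_card/subsetP=> Y /imsetP[Z /(subsetP sX)].
  by case/imsetP=> x _ -> ->; rewrite GE mem_classes.
split=> [|ab].
  rewrite (cardsD1 b) addnC leq_add ?leq_b1 //.
  apply: leq_trans _ (imG _ (subD1set (link_classes S) b)).
  rewrite (@card_in_imset _ _ G) // => X Y /setD1P[nX /imsetP[x _ XE]].
  case/setD1P=> nY /imsetP[y _ YE]; move: nX nY; rewrite XE YE !GE => nX nY.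
  move/class_eqP/connect_link_setU1 => [xy|H]; first exact/class_eqP.
  have nb z : link_class S z != b -> z \in [set x; y] ->
      link_class S (g (i, true)) = link_class S z.
    move=> nz /H; rewrite inE => /orP[|]; rewrite inE => /class_eqP // E.
    by rewrite -E eqxx in nz.
  by rewrite -(nb x) ?(nb y) // !inE eqxx ?orbT.
apply: leq_trans _ (imG _ (subxx (link_classes S)));
  rewrite (@card_in_imset _ _ G) //.
move=> _ _ /imsetP[x _ ->] /imsetP[y _ ->]; rewrite !GE.
move/class_eqP/connect_link_setU1 => [xy|H]; first exact/class_eqP.
have nb z : z \in [set x; y] -> link_class S (g (i, true)) = link_class S z.
  move=> /H; rewrite inE => /orP[|]; rewrite inE => /class_eqP // <-.
  exact/class_eqP.
by rewrite -(nb x) ?(nb y) // !inE eqxx ?orbT.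
Qed.

Lemma card_classes0 : #|link_classes set0| = #|T|.
Proof.
have E x : link_class set0 x = [set x].
  apply/setP=> y; rewrite !inE; apply/idP/eqP=> [/connectP[[|z p] /=]|->] //.
  by case/andP=> /existsP[d]; rewrite inE.
rewrite card_imset ?cardsT //; first by move=> x y; rewrite !E => /set1_inj.
Qed.

(** An element untouched by [S] is a class by itself, and an end of an edge of [S] lies in a class
    that is none of these. *)
Lemma card_untouched_lt S : S != set0 ->
  #|[set x | [forall d : I * bool, (d.1 \in S) ==> (g d != x)]]| <
    #|link_classes S|.
Proof.
case/set0Pn=> i iS; set U := [set x | _].
have Us x y : x \in U -> connect (link S) x y -> x = y.
  rewrite inE => /forallP xU /connectP[[|z p]] //=
    /andP[/existsP[d /and3P[dS dx _]] _ _].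
  by have := xU d; rewrite dS dx.
have inj : {in U &, injective (link_class S)}.
  by move=> x y xU _ /class_eqP; apply: Us.
rewrite -(card_in_imset inj) (cardsD1 (link_class S (g (i, true)))
  (link_classes S)).
rewrite mem_classes add1n ltnS; apply/subset_leq_card/subsetP=> _
  /imsetP[x xU ->].
rewrite !inE mem_classes andbT; apply/eqP=> /class_eqP /(Us _ _ xU) xE.
by move: xU; rewrite inE => /forallP/(_ (i, true)); rewrite iS xE eqxx.
Qed.

End Classes.

(** * Euler's inequality for a subgraph of a plane map *)

Section Map.
Variables (V E F : finType).
Variables (base : E * bool -> V) (rot : E * bool -> E * bool).
Variables (f : E * bool -> F).
Hypothesis rot_inj : injective rot.
Hypothesis base_rot : forall d, base (rot d) = base d.
Hypothesis face_rot : forall d, f (rot d) = f (flip d).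

(* The boundary of a set of faces is a cycle; a cycle crosses a cut an even
   number of times, so an edge separating two classes of faces is no bridge. *)
Lemma not_bridge (K : {set E}) e : e \notin K ->
  ~~ connect (link f (~: (e |: K))) (f (e, true)) (f (e, false)) ->
  connect (link base K) (base (e, true)) (base (e, false)).
Proof.
move=> eK nf; apply/negPn/negP=> nb.
pose A := link_class base K (base (e, true)).
pose C := link_class f (~: (e |: K)) (f (e, true)).
(* The boundary of the face set [C] as an antisymmetric integer flow. It is conserved at each
   vertex, because the left face of [rot d] is the right face of [d]. *)
pose z d : int := ((f d \in C)%:R - (f (flip d) \in C)%:R)%R.
have zflip d : z (flip d) = (- z d)%R by rewrite /z flipK opprB.
have sum0 : (\sum_(d | base d \in A) z d = 0)%R.
  rewrite /z big_split /= sumrN.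
  rewrite [X in (X - _)%R](reindex_inj rot_inj) /=.
  under eq_bigl do rewrite base_rot.
  under eq_bigr do rewrite face_rot.
  by rewrite subrr.
rewrite (bigID (fun d => base (flip d) \in A)) /= in sum0.
have in0 : (\sum_(d | (base d \in A) && (base (flip d) \in A)) z d = 0)%R.
  set S := (\sum_(_ | _) _)%R.
  have SN : (S = - S)%R.
    rewrite {1}/S (reindex_inj (inv_inj (@flipK E))) /= -sumrN.
    apply: eq_big => [d|d _]; first by rewrite flipK andbC.
    exact: zflip.
  clearbody S; lia.
have eA : base (e, true) \in A by rewrite class_refl.
have eA' : base (e, false) \notin A by rewrite inE.
rewrite in0 add0r (bigD1 (e, true)) /= ?eA ?eA' // in sum0.
(* No other dart leaves [A] with a nonzero flow: edges of [K] stay in [A], and the remaining edges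
   have both sides in the same class of faces. *)
rewrite big1 in sum0; last first.
  move=> [i b] /andP[/andP[iA niA] ne].
  have iK : i \notin e |: K.
    rewrite in_setU1 negb_or; apply/andP; split.
      apply/eqP=> ie; move: iA niA ne; rewrite ie /flip; case: b => //=.
        by rewrite eqxx.
      by rewrite (negPf eA').
    apply/negP=> iK; case/negP: niA; move: iA; rewrite !inE => /connect_trans.
    by apply; apply/connect1/(@linkI _ _ base K (i, b)).
  have E' : (f (i, b) \in C) = (f (flip (i, b)) \in C).
    have ld : link f (~: (e |: K)) (f (i, b)) (f (flip (i, b))).
      by apply: linkI; rewrite inE.
    rewrite !inE; apply/idP/idP => /connect_trans; apply; apply: connect1 => //.
    by rewrite link_sym.
  by rewrite /z E' subrr.
move: sum0; rewrite /z /flip /= class_refl.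
by have /negPf-> : f (e, false) \notin C by rewrite inE.
Qed.

Hypothesis euler : #|E| + 2 <= #|V| + #|F|.
Hypothesis connected : #|link_classes base setT| <= 1.

(** Delete the edges outside [K] one at a time, starting from [euler]; each deletion lowers [#|K|]
    by one. Either the two faces of the edge were already merged, and the components gain at most
    one, or [not_bridge] applies: the components do not grow and the faces lose at most one. *)
Lemma euler_deletion (K : {set E}) :
  #|K| + #|link_classes base K| < #|V| + #|link_classes f (~: K)|.
Proof.
have [n] := ubnP #|~: K|; elim: n K => // n IH K; rewrite ltnS => le.
have [E0|/set0Pn[e]] := eqVneq (~: K) set0.
  have -> : K = setT by rewrite -[K]setCK E0 setC0.
  rewrite setCT card_classes0 cardsT -addnS.
  by apply: leq_trans euler; rewrite leq_add2l ltnS.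
rewrite inE => eK.
have cE : ~: K = e |: ~: (e |: K).
  by apply/setP=> i; rewrite !inE; case: eqVneq => [->|].
have /IH : #|~: (e |: K)| < n.
  by rewrite cE cardsU1 !inE eqxx /= add1n in le.
rewrite cardsU1 eK /= add1n.
have [v1 v2] := card_classes_setU1 base K e.
have [f1 f2] := card_classes_setU1 f (~: (e |: K)) e.
rewrite -cE in f1 f2.
have := not_bridge eK.
case: (connect (link f (~: (e |: K))) _ _)
  f2 => [/(_ isT) f2 _|_ /(_ isT)/v2 {}v2].
  move: v1 f2; clear; move: #|K| #|V| #|link_classes f (~: K)|.
  by move: #|link_classes base K| #|link_classes base (e |: K)| #|link_classes f
    (~: (e |: K))|; lia.
move: f1 v2; clear; move: #|K| #|V| #|link_classes f (~: K)|.
by move: #|link_classes base K| #|link_classes base (e |: K)| #|link_classes f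
  (~: (e |: K))|; lia.
Qed.

(** The vertices off [K] are components of their own, and there is at least one more component;
    discarding these vertices from [euler_deletion] leaves Euler's inequality for a possibly
    disconnected [K]. *)
Lemma euler_support (K : {set E}) : K != set0 ->
  #|K| + 2 <= #|[set base d | d : E * bool & d.1 \in K]| +
    #|link_classes f (~: K)|.
Proof.
move=> /(card_untouched_lt base) lt; have := euler_deletion K.
rewrite -(cardsC [set base d | d : E * bool & d.1 \in K]).
suff -> : ~: [set base d | d : E * bool & d.1 \in K] =
    [set x | [forall d : E * bool, (d.1 \in K) ==> (base d != x)]] by lia.
apply/setP=> x; rewrite !inE; apply/idP/forallP => [/imsetP H d|H].
  apply/implyP=> dK; apply/eqP=> dx; case: H; exists d => //.
  by rewrite inE.
apply/imsetP=> -[d]; rewrite inE => dK xd.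
by have := H d; rewrite dK xd eqxx.
Qed.

End Map.

(** * First return of a permutation to a subset *)

Section FirstReturn.
Variables (T : finType) (r : T -> T) (S : pred T).
Hypothesis r_inj : injective r.

(** The body is that of [live_next] for an arbitrary map and predicate, so that the two are
    convertible. *)
Definition first_return x := head x [seq y <- traject r (r x) #|T| | S y].

Lemma first_returnP x : S x -> exists m,
  [/\ first_return x = iter m.+1 r x, S (iter m.+1 r x)
    & forall i, i < m -> ~~ S (iter i.+1 r x)].
Proof.
move=> Sx; set s := traject r (r x) #|T|.
have nths i : i < #|T| -> nth x s i = iter i.+1 r x.
  by move=> lt; rewrite (set_nth_default (r x)) ?size_traject // nth_traject //
    iterSr.
have hasS : has S s.
  have lt : (fingraph.order r x).-1 < #|T|.
    by rewrite prednK ?fingraph.order_gt0 ?max_card.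
  apply/(has_nthP x); exists (fingraph.order r x).-1; rewrite ?size_traject //.
  by rewrite nths // prednK ?fingraph.order_gt0 // iter_order.
have ltm : find S s < #|T| by rewrite -[X in _ < X](size_traject r (r x))
  -has_find.
exists (find S s); split; last 1 first.
- move=> i lt; rewrite -nths ?(ltn_trans lt) //.
  by rewrite (before_find x lt).
- rewrite -nths // /first_return -/s.
  elim: (s) hasS => //= y s' IH; case: ifP => //= _; exact: IH.
- by rewrite -nths // nth_find.
Qed.

Lemma first_return_iter x m : S x -> S (iter m.+1 r x) ->
  (forall i, i < m -> ~~ S (iter i.+1 r x)) -> first_return x = iter m.+1 r x.
Proof.
move=> Sx Sm nS; have [k [-> Sk nSk]] := first_returnP Sx.
case: (ltngtP k m) => [/nS|/nSk|-> //]; last by rewrite Sm.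
by rewrite Sk.
Qed.

Lemma first_return_in x : S x -> S (first_return x).
Proof. by case/first_returnP=> m [->]. Qed.

(** If [x] returns in fewer steps than [y] to the same point, cancelling the steps of [x] puts [x],
    a point of [S], strictly inside the excursion of [y]. *)
Lemma first_return_inj : {in S &, injective first_return}.
Proof.
have iter_inj k : injective (iter k r).
  by elim: k => //= k IH x y /r_inj /IH.
have aux x y m k : S x -> m <= k -> iter m.+1 r x = iter k.+1 r y ->
    (forall i, i < k -> ~~ S (iter i.+1 r y)) -> x = y.
  move=> Sx le; rewrite -{1}(subnKC le) -addSn iterD => /iter_inj xE nS.
  case E: (k - m) xE => [//|j] xE.
  by have := nS j; rewrite -xE Sx => /(_ _)/negP[] //; lia.
move=> x y Sx Sy; have [m [-> Sm nSm]] := first_returnP Sx.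
have [k [-> Sk nSk]] := first_returnP Sy => E.
case: (leqP m k) => [le|/ltnW le]; first exact: aux E nSk.
by apply/esym/(aux _ _ _ _ Sy le (esym E) nSm).
Qed.

End FirstReturn.

(** * Corner counting in a directed plane graph *)

Definition dart_in (E : finType) (K : {set E}) : pred (E * bool) :=
  fun d => d.1 \in K.

Definition next_dart (E : finType) (rot : E * bool -> E * bool) (K : {set E}) :=
  first_return rot (dart_in K).

Definition face_class (E F : finType) (f : E * bool -> F) (K : {set E}) d :=
  link_class f (~: K) (f d).

Section Index.
Variables (V E F : finType).
Variables (base : E * bool -> V) (rot : E * bool -> E * bool).
Variables (f : E * bool -> F) (out : E * bool -> bool).
Hypothesis rot_inj : injective rot.
Hypothesis base_rot : forall d, base (rot d) = base d.
Hypothesis rot_conn : forall d d', base d = base d' -> fconnect rot d d'.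
Hypothesis face_rot : forall d, f (rot d) = f (flip d).
Hypothesis face_surj : forall x, exists d, f d = x.
Hypothesis out_flip : forall d, out (flip d) = ~~ out d.
Hypothesis euler : #|E| + 2 <= #|V| + #|F|.
Hypothesis connected : #|link_classes base setT| <= 1.
Variable K : {set E}.
Hypothesis K_neq0 : K != set0.

Local Notation inK := (dart_in K).
Local Notation nx := (next_dart rot K).
Local Notation cl := (face_class f K).

Let nx_in d : inK d -> inK (nx d).
Proof. exact: first_return_in. Qed.

Let nx_inj : {in inK &, injective nx}.
Proof. exact: first_return_inj. Qed.

Let base_iter m d : base (iter m rot d) = base d.
Proof. by elim: m => //= m <-. Qed.

Lemma base_next_dart d : inK d -> base (nx d) = base d.
Proof. by rewrite /next_dart => /(first_returnP rot_inj)[m [-> _ _]];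
  rewrite base_iter. Qed.

Let cl_rot d : cl (rot d) = cl (flip d).
Proof. by rewrite /face_class face_rot. Qed.

(** The darts strictly between [d] and [nx d] belong to deleted edges, and the two sides of such an
    edge are merged. *)
Lemma face_class_next d : inK d -> cl (nx d) = cl (flip d).
Proof.
rewrite /next_dart => /(first_returnP rot_inj)[m [-> _ nS]].
elim: m nS => [|m IH] nS; first by rewrite /= cl_rot.
rewrite iterS cl_rot -IH => [|i lt]; last exact/nS/ltnW.
rewrite /face_class -class_link ?inE //; exact: nS.
Qed.

Let card_nx (P : pred (E * bool)) :
  #|[set d | inK d && P (nx d)]| = #|[set d | inK d && P d]|.
Proof.
set A := [set d | inK d]; have nxA : nx @: A = A.
  apply/eqP; rewrite eqEcard; apply/andP; split.
    by apply/subsetP=> _ /imsetP[d + ->]; rewrite !inE; apply: nx_in.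
  by rewrite card_in_imset // => x y; rewrite !inE; apply: nx_inj.
rewrite -(card_in_imset (f := nx)); last first.
  by move=> x y; rewrite !inE => /andP[xK _] /andP[yK _]; apply: nx_inj.
apply: eq_card => d; apply/imsetP/idP.
  by case=> d'; rewrite !inE => /andP[/nx_in dK Pd] ->; rewrite dK.
rewrite inE => /andP[dK Pd]; have : d \in A by rewrite inE.
rewrite -nxA => /imsetP[d']; rewrite inE => d'K dE; exists d' => //.
by rewrite inE d'K -dE.
Qed.

Let card_flip (P : pred (E * bool)) :
  #|[set d | inK d && P (flip d)]| = #|[set d | inK d && P d]|.
Proof.
rewrite -(card_imset _ (inv_inj (@flipK E))); apply: eq_card => d.
apply/imsetP/idP.
  by case=> d'; rewrite !inE => /andP[dK Pd] ->; rewrite Pd andbT.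
by rewrite inE => dP; exists (flip d); rewrite ?flipK // inE flipK.
Qed.

Let card_split (P Q : pred (E * bool)) :
  #|[set d | inK d && P d]| = #|[set d | inK d && (P d && Q d)]| +
    #|[set d | inK d && (P d && ~~ Q d)]|.
Proof.
rewrite -(cardsID [set d | Q d]).
by congr (_ + _); apply: eq_card => d; rewrite !inE -?andbA //; case: (Q d);
  rewrite ?andbT ?andbF.
Qed.

(** The dart [d] stands for the corner from [d] to [nx d], which lies in the class [cl (nx d)].
    [out_in] and [in_out] are the passages at a vertex, [out_out] and [in_in] the source and sink
    turns of a face. *)
Definition out_in v :=
  [set d | inK d && ((base d == v) && (out d && ~~ out (nx d)))].
Definition in_out v :=
  [set d | inK d && ((base d == v) && (~~ out d && out (nx d)))].
Definition out_out c :=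
  [set d | inK d && ((cl (nx d) == c) && (out d && out (nx d)))].
Definition in_in c :=
  [set d | inK d && ((cl (nx d) == c) && (~~ out d && ~~ out (nx d)))].

(** Outgoing and incoming stretches alternate around [v]. For the count, [nx] permutes the darts at
    [v], and the corners with both darts outgoing cancel. *)
Lemma card_in_out v : #|in_out v| = #|out_in v|.
Proof.
have := card_nx (fun d => (base d == v) && out d).
rewrite (card_split (fun d => (base (nx d) == v) && out (nx d)) out).
rewrite (card_split (fun d => (base d == v) && out d) (fun d => out (nx d))).
have -> : [set d | inK d && ((base (nx d) == v) && out (nx d) && out d)] =
   [set d | inK d && ((base d == v) && out d && out (nx d))].
  apply/setP=> d; rewrite !inE; case dK: (inK d) => //=.
  by rewrite base_next_dart // andbAC.
move/addnI; rewrite /in_out /out_in => E1.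
suff -> : [set d | inK d && ((base d == v) && (~~ out d && out (nx d)))] =
   [set d | inK d && ((base (nx d) == v) && out (nx d) && ~~ out d)].
  by rewrite E1; apply: eq_card => d; rewrite !inE -!andbA.
apply/setP=> d; rewrite !inE; case dK: (inK d) => //=.
by rewrite base_next_dart // andbA andbAC.
Qed.

(** Forward and backward stretches alternate along the boundary of [c]. The outgoing darts of the
    class are counted once as [nx d] and once as [flip d]. *)
Lemma card_in_in c : #|in_in c| = #|out_out c|.
Proof.
have := card_nx (fun d => (cl d == c) && out d).
rewrite -(card_flip (fun d => (cl d == c) && out d)).
have -> : [set d | inK d && ((cl (flip d) == c) && out (flip d))] =
    [set d | inK d && ((cl (nx d) == c) && ~~ out d)].
  apply/setP=> d; rewrite !inE; case dK: (inK d) => //=.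
  by rewrite face_class_next // out_flip.
rewrite (card_split (fun d => (cl (nx d) == c) && out (nx d)) out).
rewrite (card_split (fun d => (cl (nx d) == c) && ~~ out d)
  (fun d => out (nx d))).
have -> : [set d | inK d && ((cl (nx d) == c) && out (nx d) && ~~ out d)] =
    [set d | inK d && ((cl (nx d) == c) && ~~ out d && out (nx d))].
  by apply/setP=> d; rewrite !inE andbAC.
rewrite addnC => /addnI; rewrite /in_in /out_out => E1.
transitivity #|[set d | inK d && ((cl (nx d) == c) && ~~ out d &&
  ~~ out (nx d))]|.
  by apply: eq_card => d; rewrite !inE -!andbA.
by rewrite -E1; apply: eq_card => d; rewrite !inE -andbA [out d && _]andbC.
Qed.

Lemma card_face_class c :
  #|[set d | inK d && (cl d == c)]| =
  #|[set d | inK d && ((cl (nx d) == c) && (out d != out (nx d)))]| +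
  #|out_out c|.*2.
Proof.
rewrite -card_nx -addnn -{1}card_in_in.
rewrite (card_split _ (fun d => out d != out (nx d))); congr (_ + _).
rewrite (card_split _ out) addnC; congr (_ + _).
  apply: eq_card => d; rewrite !inE -andbA.
  by case: (out d); case: (out _); rewrite ?andbF.
apply: eq_card => d; rewrite !inE -andbA.
by case: (out d); case: (out _); rewrite ?andbF.
Qed.

Let VK := [set base d | d : E * bool & d.1 \in K].

Let card_out : #|[set d | inK d && out d]| = #|K|.
Proof.
rewrite -(card_in_imset (f := fst)).
  apply: eq_card => i; apply/imsetP/idP => [[d]|iK].
    by rewrite inE => /andP[dK _] ->.
  exists (i, out (i, true)) => //; rewrite inE /dart_in iK /=.
  case E0: (out (i, true)) => //.
  by have := out_flip (i, true); rewrite E0.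
move=> [i b] [j b']; rewrite !inE /= => /andP[_ o] /andP[_ o'] ij.
rewrite -{}ij in o' *; apply/eqP; rewrite xpair_eqE eqxx /=; apply/negPn/negP.
move=> ne; have := out_flip (i, b); rewrite o /flip /=.
have -> : ~~ b = b' by move: ne; case: (b); case: (b').
by rewrite o'.
Qed.

(** Charge each edge to the corner that follows its outgoing dart: a passage if the next dart is
    incoming, a source turn otherwise. *)
Lemma index_sum :
  #|K| = \sum_(v in VK) #|out_in v| + \sum_(c in link_classes f (~: K))
    #|out_out c|.
Proof.
rewrite -card_out (card_split out (fun d => out (nx d))) addnC; congr (_ + _).
  rewrite -sum1_card (partition_big base (mem VK)) /=; last first.
    by move=> d; rewrite !inE => /andP[dK _]; apply/imsetP; exists d;
      rewrite ?inE.
  apply: eq_bigr => v _; rewrite -sum1_card; apply: eq_bigl => d.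
  by rewrite !inE -!andbA [in RHS](andbC (base d == v)) -!andbA.
rewrite -sum1_card (partition_big (fun d => cl (nx d))
  (mem (link_classes f (~: K)))) /=; last first.
  by move=> d _; apply: mem_classes.
apply: eq_bigr => c _; rewrite -sum1_card; apply: eq_bigl => d.
by rewrite !inE -!andbA [in RHS](andbC (_ == c)) -!andbA.
Qed.

(** Otherwise the darts of the class would be closed under [flip] and [rot], hence would be all
    darts by connectedness, although [K] is not empty. *)
Lemma class_has_dart c : c \in link_classes f (~: K) ->
  exists2 d, inK d & cl d = c.
Proof.
case/imsetP=> x _ ->; have [d <-] := face_surj x => {x}.
case/set0Pn: K_neq0 => i iK.
case: (pickP [pred d' | inK d' && (cl d' == cl d)]) => [d' /andP[? /eqP ?]|nK].
  by exists d'.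
exists (i, true) => //.
have nKP d' : cl d' = cl d -> ~~ inK d'.
  by move=> E0; have := nK d'; rewrite /= E0 eqxx andbT => ->.
have Pflip d' : cl d' = cl d -> cl (flip d') = cl d.
  by move=> E0; rewrite -E0 /face_class [RHS]class_link // inE; apply: nKP.
have Pbase d1 d2 : base d1 = base d2 -> cl d1 = cl d -> cl d2 = cl d.
  move=> /rot_conn /connectP[p]; elim: p d1 => [|z p IH] d1 /=;
    first by move=> _ ->.
  by case/andP=> /eqP <- /IH {}IH /IH {}IH /Pflip; rewrite -cl_rot.
have : connect (link base setT) (base d) (base (i, true)).
  apply/class_eqP/eqP; apply: contraLR connected => ne; rewrite -ltnNge.
  rewrite (cardsD1 (link_class base setT (base d))) mem_classes.
  rewrite (cardsD1 (link_class base setT (base (i, true)))) !inE mem_classes.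
  by rewrite eq_sym ne.
case/connectP=> p; move: (erefl (cl d)); rewrite -/(cl d).
suff H d1 : cl d1 = cl d -> path (link base setT) (base d1) p ->
  base (i, true) = last (base d1) p -> cl (i, true) = cl d by apply: H.
elim: p d1 => [|z p IH] d1 Pd1 /=; first by move=> _ /esym/Pbase; apply.
case/andP=> /existsP[e /and3P[_ /eqP eb /eqP ez]] pz pl.
apply: (IH (flip e)); rewrite ?ez //.
exact/Pflip/(Pbase d1).
Qed.

Variable hub : V.
Variable h : V -> nat.
Hypothesis h_incr : forall d, inK d -> out d -> base d != hub ->
  base (flip d) != hub -> h (base d) < h (base (flip d)).

(* Without turns, the boundary of a class contains a directed closed walk,
   which has to run through the hub. *)
Lemma turnless_class c : c \in link_classes f (~: K) -> #|out_out c| = 0 ->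
  exists2 d, d \in out_in hub :|: in_out hub & cl (nx d) = c.
Proof.
move=> cC oo0; case: (pickP [pred d | (d \in out_in hub :|: in_out hub) &&
  (cl (nx d) == c)]) => [d /andP[dH /eqP dc]|nH]; first by exists d.
have [d0 d0K d0c] := class_has_dart cC.
(* [phi] follows the boundary of the class inside [K]. With no turn and no passage at the hub,
   [step] keeps it running in the same direction and off the hub. *)
pose phi d := nx (flip d); pose Q d := inK d && (cl d == c).
have Qphi d : Q d -> Q (phi d).
  case/andP=> dK dc; have dK' : inK (flip d) by [].
  by rewrite /Q nx_in // face_class_next // flipK.
have step d : Q d -> out (phi d) = out d /\ base (phi d) != hub.
  move=> Qd; have /andP[dK dc] := Qd; have dK' : inK (flip d) by [].
  have /andP[_ pc] := Qphi _ Qd; rewrite -/(nx (flip d)) in pc.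
  have O : out (phi d) = out d.
    apply/eqP/negPn/negP=> ne.
    have := out_flip d; case od: (out d) ne => ne ofd.
      have := card_in_in c; rewrite oo0 => /eqP; rewrite cards_eq0.
      by move/eqP/setP/(_ (flip d)); rewrite !inE pc dK' ofd -/(phi d); case:
        (out _) ne.
    move/eqP: oo0; rewrite cards_eq0.
    by move/eqP/setP/(_ (flip d)); rewrite !inE pc dK' ofd -/(phi d); case:
      (out _) ne.
  split=> //; rewrite base_next_dart //; apply/negP=> bh.
  have := nH (flip d); rewrite !inE dK' bh pc -/(phi d) O out_flip /= andbT.
  by case: (out d).
have Qit n : Q (iter n phi (phi d0)).
  elim: n => [|n IH] /=; last exact: Qphi.
  by apply: Qphi; rewrite /Q d0K d0c eqxx.
have bit n : base (iter n phi (phi d0)) != hub.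
  case: n => [|n] /=; last by case: (step _ (Qit n)).
  by case: (step d0) => //; rewrite /Q d0K d0c eqxx.
have oit n : out (iter n phi (phi d0)) = out (phi d0).
  by elim: n => //= n <-; case: (step _ (Qit n)).
have bphi n : base (flip (iter n phi (phi d0))) = base (iter n.+1 phi (phi d0)).
  have /andP[dK _] := Qit n; rewrite /= base_next_dart //.
(* Running forwards, the height grows without bound; running backwards, it decreases forever. *)
case O: (out (phi d0)).
  have gr n : n <= h (base (iter n phi (phi d0))).
    elim: n => // n IH; apply: leq_ltn_trans IH _; rewrite -bphi.
    have /andP[dK _] := Qit n.
    by apply: h_incr; rewrite ?oit // bphi; apply: (bit n.+1).
  have := gr (\max_v h v).+1; rewrite leqNgt ltnS.
  by rewrite (leq_bigmax (F := h)).
have gr n : n + h (base (iter n phi (phi d0))) <= h (base (phi d0)).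
  elim: n => // n IH; apply: leq_trans IH; rewrite addSnnS leq_add2l.
  rewrite -bphi; have /andP[dK _] := Qit n.
  have := @h_incr (flip (iter n phi (phi d0))); rewrite flipK; apply => //.
  - by rewrite out_flip oit O.
  - by rewrite bphi; apply: (bit n.+1).
have := gr (h (base (phi d0))).+1; lia.
Qed.

Hypothesis has_in_and_out : forall d b, inK d -> base d != hub ->
  exists d', [/\ inK d', base d' = base d & out d' = b].

(** Rotating from an outgoing dart to an incoming one, some step passes from out to in; the
    induction is on the number of rotation steps that remain. *)
Lemma out_in_gt0 v : v \in VK -> v != hub -> 0 < #|out_in v|.
Proof.
case/imsetP=> d; rewrite inE => dK -> nh.
have [d1 [K1 b1 o1]] := has_in_and_out true dK nh.
have [d2 [K2 b2 o2]] := has_in_and_out false dK nh.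
have /rot_conn/iter_findex : base d1 = base d2 by rewrite b1.
move: (findex rot d1 d2) => n; have [N] := ubnP n.
elim: N n d1 K1 b1 o1 => // N IH n d1 K1 b1 o1 lt d2E.
have [m [nE nK nS]] := first_returnP rot_inj K1.
case O: (out (nx d1)); last first.
  by apply/card_gt0P; exists d1; rewrite !inE K1 b1 eqxx o1 O.
have le : m.+1 <= n.
  case: n d2E {lt} => [/= d2E|n d2E]; first by rewrite -d2E o1 in o2.
  rewrite ltnS leqNgt; apply/negP=> /nS.
  by rewrite -d2E in K2; rewrite K2.
apply: (IH (n - m.+1) (nx d1)); rewrite ?nx_in ?base_next_dart //; first by lia.
by rewrite /next_dart nE -iterD subnK.
Qed.

Hypothesis hub_le1 : #|out_in hub| <= 1.

Let Z := [set c in link_classes f (~: K) | #|out_out c| == 0].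

(** By [turnless_class] each class of [Z] owns a passage at the hub, of either kind, and both kinds
    are equally many. *)
Let card_Z : #|Z| <= #|out_in hub|.*2.
Proof.
rewrite -addnn -{2}card_in_out; apply: leq_trans (leq_card_setU _ _).
apply: leq_trans (leq_imset_card (fun d => cl (nx d)) _).
apply/subset_leq_card/subsetP=> c; rewrite inE => /andP[cC /eqP c0].
by have [d dH dc] := turnless_class cC c0; apply/imsetP; exists d.
Qed.

Let sum_ge (T : finType) (A : {set T}) (g : T -> nat) :
  (forall x, x \in A -> 0 < g x) -> #|A| <= \sum_(x in A) g x.
Proof. by move=> gA; rewrite -sum1_card; apply: leq_sum. Qed.

Let sum_gt (T : finType) (A : {set T}) (g : T -> nat) x :
  (forall x, x \in A -> 0 < g x) -> x \in A ->
  #|A| + g x <= (\sum_(x in A) g x).+1.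
Proof.
move=> gA xA; rewrite (big_setD1 x) //= (cardsD1 x A) xA.
have := @sum_ge _ (A :\ x) g; set S := \sum_(_ in _) _ => H.
suff : #|A :\ x| <= S by lia.
by apply: H => y /setD1P[_ /gA].
Qed.

(** Put [index_sum] into Euler's inequality for [K]. With p passages at the hub, the hub and the
    turnless classes leave a surplus of at most 1 + 2p - p - 2, which is not positive since p <=
    1. *)
Let tight : 
  \sum_(v in VK :\ hub) #|out_in v| +
  \sum_(c in link_classes f (~: K) :\: Z) #|out_out c| <=
  #|VK :\ hub| + #|link_classes f (~: K) :\: Z|.
Proof.
have es := euler_support rot_inj base_rot face_rot euler connected K_neq0.
have Zs : Z \subset link_classes f (~: K) by apply/subsetP=> c;
  rewrite inE => /andP[].
have sC : \sum_(c in link_classes f (~: K)) #|out_out c| =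
    \sum_(c in link_classes f (~: K) :\: Z) #|out_out c|.
  rewrite (big_setID Z) /= big1 => [|c]; first by rewrite add0n.
  by rewrite !inE => /andP[_ /andP[_ /eqP]].
have cC : #|link_classes f (~: K)| = #|Z| + #|link_classes f (~: K) :\: Z|.
  by rewrite -(cardsID Z) (setIidPr Zs).
have [hV hV'] : \sum_(v in VK :\ hub) #|out_in v| + #|out_in hub| <=
    \sum_(v in VK) #|out_in v| /\ #|VK| <= #|VK :\ hub|.+1.
  rewrite [#|VK|](cardsD1 hub); split; last by case: (_ \in _).
  case: (boolP (hub \in VK)) => hV.
    by rewrite (big_setD1 hub hV) /= addnC.
  have -> : VK :\ hub = VK by apply/setDidPl; rewrite disjoint_sym disjoints1.
  rewrite [#|out_in hub|]eq_card0 ?addn0 // => d.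
  rewrite !inE; apply/negP=> /and3P[dK /eqP bh _].
  by case/negP: hV; apply/imsetP; exists d; rewrite ?inE.
move: es; rewrite index_sum sC cC; have := card_Z; move: hV hV' hub_le1.
clear; set a := \sum_(_ in VK :\ _) _; set b := \sum_(_ in _ :\: _) _.
set e := \sum_(_ in VK) _; move: a b e #|VK| #|VK :\ hub| #|out_in hub| #|Z|.
by move: #|link_classes f (~: K) :\: Z|; lia.
Qed.

(** By [tight], sums of positive terms do not exceed the number of their terms, so that no term
    exceeds 1. *)
Lemma out_in_le1 v : v != hub -> #|out_in v| <= 1.
Proof.
move=> nh; case: (boolP (v \in VK)) => vV; last first.
  rewrite eq_card0 // => d; rewrite !inE; apply/negP=> /and3P[dK /eqP bv _].
  by case/negP: vV; apply/imsetP; exists d; rewrite ?inE.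
have := @sum_ge _ (link_classes f (~: K) :\: Z) (fun c => #|out_out c|).
have := @sum_gt _ (VK :\ hub) (fun v => #|out_in v|) v.
move: tight; rewrite !inE nh vV; set a := \sum_(_ in VK :\ _) _.
set b := \sum_(_ in _ :\: _) _ => le Ha Hb.
have {}Ha : #|VK :\ hub| + #|out_in v| <= a.+1.
  by apply: Ha => // u /setD1P[uh /out_in_gt0]; apply.
have {}Hb : #|link_classes f (~: K) :\: Z| <= b.
  by apply: Hb => c; rewrite !inE => /andP[+ cC]; rewrite cC lt0n.
move: le Ha Hb; clear; move: #|VK :\ hub| #|_ :\: _| #|out_in v|; lia.
Qed.

(** The hypothesis keeps [c] out of [Z], since a turnless class has a passage at the hub; then
    [tight] leaves it exactly one source turn. *)
Lemma out_out_eq1 c : c \in link_classes f (~: K) ->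
  (forall d, inK d -> cl (nx d) = c -> base d != hub) -> #|out_out c| = 1.
Proof.
move=> cC nh; have cZ : c \in link_classes f (~: K) :\: Z.
  rewrite !inE cC andbT; apply/negP=> /eqP/(turnless_class cC)[d].
  rewrite !inE => /orP[] /and3P[dK /eqP bh _] /(nh _ dK); by rewrite bh eqxx.
have Zc c' : c' \in link_classes f (~: K) :\: Z -> 0 < #|out_out c'|.
  by rewrite !inE => /andP[+ c'C]; rewrite c'C lt0n.
have := @sum_gt _ (link_classes f (~: K) :\: Z) (fun c => #|out_out c|) c Zc cZ.
have := @sum_ge _ (VK :\ hub) (fun v => #|out_in v|).
have := Zc c cZ; move: tight; set a := \sum_(_ in VK :\ _) _.
set b := \sum_(_ in _ :\: _) _ => le c0 Ha Hb.
have {}Ha : #|VK :\ hub| <= a.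
  by apply: Ha => u /setD1P[uh /out_in_gt0]; apply.
move: le c0 Ha Hb; clear; move: #|VK :\ hub| #|_ :\: _| #|out_out c|; lia.
Qed.

End Index.

(** * Planarity and signs *)

Section Barycentric.
Variable G : embedded_digraph.

(* The barycentric subdivision of the faces of G: one hub in each face, joined
   by a spoke to each corner of the face.  The spoke of x, which ends in the
   corner just before x, has the end true at base x and the end false at the
   hub; the face to the left of x becomes, for each dart x on its boundary, a
   triangle named x. *)
Definition hub := {c : {set dart G} | c \in faces G}.
Definition bvertex : finType := (vertex G + hub)%type.
Definition bedge : finType := (edge G + dart G)%type.

Definition hub_of (d : dart G) : hub := exist _ (left_face d) (imset_f _ isT).

Definition face_prev (d : dart G) : dart G := rev ((rot G)^-1%g d).

Definition old_dart (d : dart G) : bedge * bool := (inl d.1, d.2).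

Definition bbase (x : bedge * bool) : bvertex :=
  match x with
  | (inl e, b) => inl (base ((e, b) : dart G))
  | (inr d, b) => if b then inl (base d) else inr (hub_of d)
  end.

Definition brot (x : bedge * bool) : bedge * bool :=
  match x with
  | (inl e, b) => (inr (rot G (e, b)), true)
  | (inr d, b) => if b then old_dart d else (inr (face_prev d), false)
  end.

Definition bface (x : bedge * bool) : dart G :=
  match x with
  | (inl e, b) => (e, b)
  | (inr d, b) => if b then face_prev d else d
  end.

Lemma revK : involutive (@rev G).
Proof. by case=> e b; rewrite /rev /= negbK. Qed.

Lemma face_nextK : cancel (@face_next G) face_prev.
Proof. by move=> d; rewrite /face_prev /face_next permK revK. Qed.

Lemma face_prevK : cancel face_prev (@face_next G).
Proof. by move=> d; rewrite /face_prev /face_next revK permKV. Qed.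

Lemma face_next_inj : injective (@face_next G).
Proof. exact: can_inj face_nextK. Qed.

Lemma left_faceP (d d' : dart G) :
  reflect (left_face d = left_face d') (fconnect (@face_next G) d d').
Proof.
apply: (iffP idP) => [dd'|E].
  apply/setP=> x; rewrite !inE.
  exact: (same_connect (fconnect_sym face_next_inj) dd').
have : d' \in left_face d' by rewrite inE connect0.
by rewrite -E inE.
Qed.

Lemma left_face_prev d : left_face (face_prev d) = left_face d.
Proof. by apply/left_faceP; rewrite -{2}[d]face_prevK fconnect1. Qed.

Lemma left_face_rot d : left_face (rot G d) = left_face (rev d).
Proof. by apply/esym/left_faceP; rewrite -{2}[d]revK fconnect1. Qed.

Lemma brot_inj : injective brot.
Proof.
have prev_inj : injective face_prev := can_inj face_prevK.
move=> [[e|d] b] [[e'|d'] b'] //=.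
- by case=> /perm_inj[-> ->].
- by case: b'.
- by case: b.
case: b b' => [] [] // E.
  by case: d d' E => ? ? [? ?] [-> ->].
have /= /prev_inj -> // := congr1 (fun x => if x.1 is inr y then y else d) E.
Qed.

Lemma bface_rot d : bface (brot d) = bface (flip d).
Proof.
case: d => [[e|d] []] //=; rewrite ?/face_prev ?permK //.
by case: d.
Qed.

Lemma bface_surj x : exists d, bface d = x.
Proof. by exists (old_dart x); case: x. Qed.

Lemma iter_brot_old i d : iter i.*2 brot (old_dart d) =
  old_dart (iter i (rot G) d).
Proof. by elim: i => //= i ->; case: (iter _ _ _). Qed.

Lemma iterS_brot_old i d :
  iter i.*2.+1 brot (old_dart d) = (inr (iter i.+1 (rot G) d), true).
Proof. by rewrite iterS iter_brot_old /=; case: (iter _ _ _). Qed.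

Hypothesis Gconn : connected_graph G.
Hypothesis Gplanar : planar_embedding G.

Lemma base_rot d : base (rot G d) = base d.
Proof.
by case: Gplanar => H _ _; apply/eqP; rewrite -H (mem_porbit _ 1 d).
Qed.

Lemma bbase_rot d : bbase (brot d) = bbase d.
Proof.
case: d => [[e|d] []] /=; rewrite ?base_rot //.
by congr inr; apply: val_inj; rewrite /= left_face_prev.
Qed.

Lemma brot_conn d d' : bbase d = bbase d' -> fconnect brot d d'.
Proof.
have sym := fconnect_sym brot_inj.
have lift_conn x y : base x = base y -> fconnect brot (old_dart x) (old_dart y).
  case: Gplanar => H _ _ /esym/eqP; rewrite -H => /porbitP[i ->].
  by rewrite permX -iter_brot_old fconnect_iter.
have up x : fconnect brot (inr x, true) (old_dart x) by apply: fconnect1.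
case: d d' => [[e|d] b] [[e'|d'] b'].
- by case=> /(lift_conn (e, b) (e', b')).
- by case: b' => //= -[/(lift_conn (e, b))] /connect_trans; apply; rewrite sym.
- by case: b => //= -[/(lift_conn _ (e', b'))]; apply: connect_trans.
case: b b' => [] [] //= [].
  by move/lift_conn => dd'; apply: connect_trans (up d) _; rewrite sym;
    apply: connect_trans (up d') _; rewrite sym.
move/left_faceP/connectP=> [p]; elim: p d => [|x p IH] d /=;
  first by move=> _ ->.
case/andP=> /eqP <- /IH {}IH /IH; apply: connect_trans; rewrite sym.
by apply: connect1; rewrite /= face_nextK.
Qed.

(** With V, E and F for [G], the subdivision has V + F vertices, 3E edges and 2E triangles, so the
    formula reduces to that of [G]. The presence of an edge removes the [maxn] of
    [planar_embedding]. *)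
Lemma bmap_euler : 0 < #|edge G| ->
  #|bedge| + 2 <= #|bvertex| + #|dart G|.
Proof.
move=> E_gt0; case: Gplanar => _ eG Fn.
have F_gt0 : 0 < #|faces G|.
  by case: Fn => [oF|E0]; [apply/card_gt0P;
    exists (outer G)|rewrite E0 in E_gt0].
rewrite !card_sum card_prod card_bool card_sig.
move: eG; rewrite (maxn_idPr F_gt0).
have -> : #|[pred x | x \in faces G]| = #|faces G| by apply: eq_card.
move: #|vertex G| #|edge G| #|faces G|; lia.
Qed.

Lemma bmap_connected : #|link_classes bbase setT| <= 1.
Proof.
have sym := @connect_link_sym _ _ bbase setT.
have vconn u v : connect (link bbase setT) (inl u) (inl v).
  have /connectP[p] := Gconn u v; elim: p u => [|z p IH] u /=.
    by move=> _ ->.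
  case/andP=> /existsP[e He] /IH {}IH /IH; apply: connect_trans.
  have L b : connect (link bbase setT) (bbase (inl e, b)) (bbase (inl e, ~~ b)).
    exact/connect1/(@linkI _ _ bbase setT (inl e, b)).
  by case/orP: He => /andP[/eqP <- /eqP <-]; [apply: (L true)|apply: (L false)].
have hconn x : exists v, connect (link bbase setT) x (inl v).
  case: x => [v|c]; first by exists v.
  case/imsetP: (valP c) => d _ dc; exists (base d).
  have -> : c = hub_of d by apply: val_inj.
  exact/connect1/(@linkI _ _ bbase setT (inr d, false)).
have all_conn x y : link_class bbase setT x = link_class bbase setT y.
  have [u xu] := hconn x; have [v yv] := hconn y; apply/class_eqP.
  by apply: connect_trans xu (connect_trans (vconn u v) _); rewrite sym.
rewrite leqNgt; apply/card_gt1P => -[_ [_ [/imsetP[x _ ->] /imsetP[y _ ->]]]].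
by rewrite (all_conn x y) eqxx.
Qed.

End Barycentric.

(** The height of [v] counts the vertices from which [v] can be reached, [v] included; it grows
    strictly along an edge because no path leads back. *)
Lemma acyclic_height (G : embedded_digraph) : acyclic G ->
  exists h : vertex G -> nat,
    (forall e, h (src e) < h (dst e)) /\ forall v, 0 < h v <= #|vertex G|.
Proof.
move=> Gac; pose r : rel (vertex G) := fun u
  v => [exists e : edge G, (src e == u) && (dst e == v)].
have dipath_cat u v z p q : dipath u v p -> dipath v z q -> dipath u z (p ++ q).
  elim: p u => [|e p IH] u /=; first by move/eqP=> ->.
  by case/andP=> -> /IH {}IH /IH.
have path_dipath u v : connect r u v -> exists p, dipath u v p.
  case/connectP=> p; elim: p u => [|x p IH] u /=; first by move=> _ ->;
    exists [::] => /=.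
  case/andP=> /existsP[e /andP[/eqP <- /eqP <-]] /IH {}IH /IH[q pq].
  by exists (e :: q); rewrite /= eqxx.
exists (fun v => #|[set u | connect r u v]|); split=> [e|v]; last first.
  by rewrite max_card andbT; apply/card_gt0P; exists v; rewrite inE connect0.
have re : connect r (src e) (dst e).
  by apply/connect1/existsP; exists e; rewrite !eqxx.
apply/proper_card/properP; split.
  by apply/subsetP=> u; rewrite !inE => /connect_trans; apply.
exists (dst e); rewrite !inE ?connect0 //; apply/negP=> /path_dipath[p pp].
by have := @Gac (src e) (e :: p); rewrite /= eqxx => /(_ pp).
Qed.

(** * Live darts and the faces left by the deletions *)

Section Pruned.
Variables (G : embedded_digraph) (L T : {set vertex G}).
Local Notation lv := (live L T).

Lemma live_L (x : dart G) : x.1 \in lv -> base x \in L -> x.2.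
Proof.
by case: x => e [] //=; rewrite inE /kept /base /= => /and3P[/andP[/negPf->]].
Qed.

Lemma live_T (x : dart G) : x.1 \in lv -> base x \in T -> x.2 = false.
Proof.
by case: x => e [] //=; rewrite inE /kept /base /= => /and3P[/andP[_ /negPf->]].
Qed.

Lemma live_transit (x : dart G) : x.1 \in lv -> base x \notin L ->
  base x \notin T -> base x \in transit L T.
Proof.
case: x => e b /= /live_ends[].
rewrite /base /= !in_setU => + + nL nT.
by case: b nL nT => /negPf sL /negPf sT; rewrite ?sL ?sT.
Qed.

Lemma transit_notin v : v \in transit L T -> (v \notin L) && (v \notin T).
Proof.
rewrite inE => /and3P[_ /exists_inP[e el /eqP ev] /exists_inP[e' el' /eqP ev']].
move: el el'; rewrite !inE /kept -{1}ev -{1}ev'.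
by move=> /and3P[/andP[-> _] _ _] /and3P[/andP[_ ->] _ _].
Qed.

Lemma merge_sym : symmetric (merge L T).
Proof.
move=> c c'; apply/existsP/existsP=> -[d /and3P[dl dx dy]];
  by exists (rev d); rewrite revK dl dx dy.
Qed.

Lemma merged_faceP c c' :
  reflect (merged_face L T c = merged_face L T c') (connect (merge L T) c c').
Proof.
have sym := sym_connect_sym merge_sym.
apply: (iffP idP) => [cc'|E].
  by apply/setP=> x; rewrite !inE (same_connect sym cc').
have : c' \in merged_face L T c' by rewrite inE connect0.
by rewrite -E inE.
Qed.

Definition dart_face (d : dart G) := merged_face L T (left_face d).

Lemma dart_face_rev d : d.1 \notin lv -> dart_face (rev d) = dart_face d.
Proof.
move=> dl; apply/esym/merged_faceP/connect1/existsP.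
by exists d; rewrite dl !eqxx.
Qed.

Lemma dart_face_rot d : dart_face (rot G d) = dart_face (rev d).
Proof. by rewrite /dart_face left_face_rot. Qed.

Lemma live_nextE d :
  live_next L T d = first_return (rot G) (fun x => x.1 \in lv) d.
Proof. by []. Qed.

End Pruned.

(** * The hub in the outside face and the sign rule *)

Section Signs.
Variables (G : embedded_digraph) (L T : {set vertex G}).
Hypothesis Gconn : connected_graph G.
Hypothesis Gplanar : planar_embedding G.
Hypothesis Gacyc : acyclic G.
Variables (d0 : dart G) (k : nat).
Hypothesis d0_outer : d0 \in outer G.
Local Notation o := (fingraph.orbit (@face_next G) d0).
Hypothesis L_arc : forall v, v \in L -> v \in take k.+1 [seq base x | x <- o].
Hypothesis T_arc : forall v, v \in T ->
  v \in drop k ([seq base x | x <- o] ++ take 1 [seq base x | x <- o]).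

Local Notation lv := (live L T).
Local Notation df := (dart_face L T).
Local Notation oface := (merged_face L T (outer G)).

Definition has_live v := [exists x : dart G, (x.1 \in lv) && (base x == v)].

(** The two arcs are those of [segregated]. An endpoint met several times on its arc gets several
    spokes; one without live darts gets none. *)
Definition spokeL := [set x in take k.+1 o | (base x \in L) &&
  has_live (base x)].
Definition spokeT := [set x in drop k (o ++ take 1 o) | (base x \in T) &&
  has_live (base x)].

Definition bkept : {set bedge G} :=
  [set e : bedge G | match e with inl e => e \in lv
                     | inr x => (x \in spokeL) || (x \in spokeT) end].

Definition bout (x : bedge G * bool) :=
  match x with (inl _, b) => b | (inr x, b) => b (+) (x \in spokeL) end.

Local Notation bcl := (face_class (@bface G) bkept).
Local Notation bnx := (next_dart (@brot G) bkept).

Let outerE : outer G = left_face d0.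
Proof.
case: Gplanar => _ _ [|E0]; last by case: (d0) => e; have := max_card (pred1 e);
  rewrite E0 card1.
case/imsetP=> d _ oE; rewrite oE; apply/left_faceP.
by move: d0_outer; rewrite oE inE.
Qed.

Let o_outer x : x \in o -> left_face x = outer G.
Proof. by rewrite -fconnect_orbit outerE => /left_faceP. Qed.

Let spoke_o x : (x \in spokeL) || (x \in spokeT) -> x \in o.
Proof.
rewrite !inE => /orP[/andP[/mem_take]|/andP[/mem_drop]] //.
by rewrite mem_cat => /orP[|/mem_take].
Qed.

Let spoke_face x : (x \in spokeL) || (x \in spokeT) -> df x = oface.
Proof. by move/spoke_o/o_outer; rewrite /dart_face => ->. Qed.

(** A live dart at a vertex of both kinds would be outgoing by [live_L] and incoming by [live_T]. *)
Let spoke_disj x : x \in spokeT -> x \notin spokeL.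
Proof.
rewrite !inE => /and3P[_ xT /existsP[y /andP[yl /eqP yx]]].
apply/negP=> /and3P[_ xL _]; rewrite -yx in xT xL.
by have := live_L yl xL; rewrite (live_T yl xT).
Qed.

Let spoke_transit x : base x \in transit L T -> (x \in spokeL) ||
  (x \in spokeT) = false.
Proof.
by move/transit_notin => /andP[nL nT]; rewrite !inE (negPf nL) (negPf nT) /=
  !andbF.
Qed.

Let bout_flip x : bout (flip x) = ~~ bout x.
Proof. by case: x => [[e|x] b] //=; rewrite addNb. Qed.

Let hub0 : bvertex G := inr (hub_of d0).

Let hub_spoke x : (x \in spokeL) || (x \in spokeT) -> inr (hub_of x) = hub0.
Proof.
by move/spoke_o/o_outer => E; congr inr; apply: val_inj; rewrite /= E outerE.
Qed.

Let dart_in_old x : dart_in bkept (old_dart x) = (x.1 \in lv).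
Proof. by rewrite /dart_in inE. Qed.

Let dart_in_spoke x b :
  dart_in bkept (inr x, b) = (x \in spokeL) || (x \in spokeT).
Proof. by rewrite /dart_in in_set. Qed.

Let mem_spokeL v : v \in L -> has_live v -> exists2 x, x \in spokeL & base x =
  v.
Proof.
move=> vL hv; have := L_arc vL; rewrite -map_take => /mapP[x xo vx].
by exists x; rewrite // inE xo -vx vL.
Qed.

Let mem_spokeT v : v \in T -> has_live v -> exists2 x, x \in spokeT & base x =
  v.
Proof.
move=> vT hv; have := T_arc vT.
rewrite -map_take -map_cat -map_drop => /mapP[x xo vx].
by exists x; rewrite // inE xo -vx vT.
Qed.

(** This is what the spokes are for: they give the left endpoints an incoming dart and the right
    endpoints an outgoing one, while transit vertices have both already. *)
Let b_in_and_out d b : dart_in bkept d -> bbase d != hub0 ->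
  exists d', [/\ dart_in bkept d', bbase d' = bbase d & bout d' = b].
Proof.
move=> dK nh; have [v vE hv] : exists2 v, bbase d = inl v & has_live v.
  case: d dK nh => [[e|x] c].
    rewrite /dart_in inE /= => el _; exists (base ((e, c) : dart G)) => //.
    by apply/existsP; exists (e, c); rewrite el eqxx.
  rewrite /dart_in inE /=; case: c => [xs _|/hub_spoke ->];
    last by rewrite eqxx.
  by exists (base x) => //; move: xs; rewrite !inE => /orP[] /and3P[].
rewrite vE; have := hv; case/existsP=> x /andP[xl /eqP xv].
have spoke y c : (y \in spokeL) || (y \in spokeT) -> dart_in bkept (inr y, c).
  by move=> ys; rewrite /dart_in inE.
case: (boolP (v \in L)) => vL.
  case: b; last first.
    have [y ys yv] := mem_spokeL vL hv.
    by exists (inr y, true); rewrite /= spoke ?ys //= yv.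
  exists (old_dart x); rewrite dart_in_old xl /= -xv; split=> //.
  by apply: (live_L xl); rewrite xv.
case: (boolP (v \in T)) => vT.
  case: b.
    have [y ys yv] := mem_spokeT vT hv.
    by exists (inr y, true); rewrite /= spoke ?ys ?orbT //= yv spoke_disj.
  exists (old_dart x); rewrite dart_in_old xl /= -xv; split=> //.
  by apply: (live_T xl); rewrite xv.
have : v \in transit L T by rewrite -xv; apply: live_transit => //; rewrite xv.
rewrite inE => /and3P[_ /exists_inP[e el /eqP ev] /exists_inP[e' el' /eqP ev']].
case: b.
  by exists (inl e', true); rewrite /dart_in inE /= el' /base /= ev'.
by exists (inl e, false); rewrite /dart_in inE /= el /base /= ev.
Qed.

Let iter_face_prev m (x : dart G) : iter m (@brot G) (inr x, false) =
  (inr (iter m (@face_prev G) x), false).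
Proof. by elim: m => //= m ->. Qed.

Let nth_prev i m : i < size o -> m <= i ->
  iter m (@face_prev G) (nth d0 o i) = nth d0 o (i - m).
Proof.
move=> lt; elim: m => [|m IH] le; first by rewrite subn0.
rewrite iterS IH ?(ltnW le) // subnS.
have -> : nth d0 o (i - m) = face_next (nth d0 o (i - m).-1).
  have -> : i - m = (i - m).-1.+1 by lia.
  rewrite /fingraph.orbit in lt *; rewrite size_traject in lt.
  by rewrite /= !nth_traject //; lia.
exact: face_nextK.
Qed.

(* The rotation at the hub runs backwards along the outside face: from the spoke
   of a left endpoint, it meets another left endpoint before any right one,
   unless it started from the first left endpoint of the arc. *)
Let hub_out_in_le1 : #|out_in (@bbase G) (@brot G) bout bkept hub0| <= 1.
Proof.
have inj := @brot_inj G.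
rewrite leqNgt; apply/card_gt1P => -[d [d' []]].
have hubE e : e \in out_in (@bbase G) (@brot G) bout bkept hub0 ->
   exists i, [/\ i < size o, i <= k, nth d0 o i \in spokeL,
     e = (inr (nth d0 o i), false) & exists m,
       [/\ bnx e = iter m.+1 (@brot G) e,
     dart_in bkept (bnx e), ~~ bout (bnx e) & forall j, j < m ->
       ~~ dart_in bkept (iter j.+1 (@brot G) e)]].
  rewrite inE => /and4P[eK /eqP eh eo eno].
  case: e eK eh eo eno => [[e|x] c] // eK; case: c eK => //= eK _ xL eno.
  have [m [mE mK nm]] := first_returnP inj eK.
  move: (xL); rewrite inE => /andP[/(nthP d0)[i]].
  rewrite size_take => lti.
  have [lt le] : i < size o /\ i < k.+1 by move: lti; case:
    (ltnP k.+1 (size o)) => /=; lia.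
  rewrite nth_take // => ix _; exists i; rewrite ix; split=> //.
  by exists m; split; rewrite // /next_dart mE.
move=> /hubE[i [ilt ik iL -> [m [mE mK mo nm]]]]
  /hubE[j [jlt jk jL -> [n [nE nK no nn]]]] {d d'}.
have aux a b q : a < b -> b < size o -> b <= k -> nth d0 o a \in spokeL ->
   bnx (inr (nth d0 o b), false) = iter q.+1 (@brot G)
     (inr (nth d0 o b), false) ->
   dart_in bkept (bnx (inr (nth d0 o b), false)) ->
   ~~ bout (bnx (inr (nth d0 o b), false)) ->
   (forall j, j < q -> ~~ dart_in bkept (iter j.+1 (@brot G)
     (inr (nth d0 o b), false))) -> False.
  move=> ab bs bk aL -> qK qo nq.
  have qab : q < b - a.
    rewrite ltnNge; apply/negP=> le.
    have [E0|ne] := eqVneq q.+1 (b - a).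
      by lia.
    have := nq (b - a).-1; rewrite prednK; last by lia.
    rewrite iter_face_prev nth_prev //; try by lia.
    have -> : b - (b - a) = a by lia.
    by rewrite dart_in_spoke aL => /(_ _)/negP[] //; lia.
  move: qK qo; rewrite iter_face_prev nth_prev //; try by lia.
  rewrite dart_in_spoke /= => /orP[->//|+ nL].
  have [E0|ne] := eqVneq (b - q.+1) a; first by rewrite E0 aL in nL.
  set c := b - q.+1 in ne *.
  have [ac cb] : a < c /\ c < b by rewrite /c; lia.
  (* A dart of [spokeT] has position at least [k], or is the repeated position 0; neither fits
     [a < c < b] with [b <= k]. *)
  rewrite inE => /andP[/(nthP d0)[r]]; rewrite size_drop size_cat
    size_take => lr.
  rewrite nth_drop nth_cat => + _.
  have uo : uniq o by apply: orbit_uniq.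
  have o0 : 0 < size o := leq_ltn_trans (leq0n _) bs.
  have cs : c < size o := ltn_trans cb bs.
  case: ifP => lt.
    by move/eqP; rewrite nth_uniq // => /eqP; lia.
  have -> : k + r - size o = 0 by move: lr lt; case: ifP => /=; lia.
  rewrite nth_take // => /eqP; rewrite nth_uniq //.
  by move/eqP; lia.
move=> ne; case: (ltngtP i j) => ij; last by rewrite ij eqxx in ne.
  exact: (aux i j n).
exact: (aux j i m).
Qed.

Let height : exists h : bvertex G -> nat, forall d, dart_in bkept d -> bout d ->
  bbase d != hub0 -> bbase (flip d) != hub0 -> h (bbase d) < h (bbase (flip d)).
Proof.
have [h [hlt _]] := acyclic_height Gacyc.
exists (fun v => if v is inl u then h u else 0) => -[[e|x] b].
  by case: b => //= _ _ _ _; apply: hlt.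
rewrite dart_in_spoke => /hub_spoke xh _.
by case: b => /=; rewrite xh eqxx.
Qed.

Let in_old d : dart_in bkept d -> df (bface d) <> oface ->
  exists2 y, y.1 \in lv & d = old_dart y.
Proof.
case: d => [[e|x] b]; first by move=> el _; exists (e, b);
  rewrite // -dart_in_old.
rewrite dart_in_spoke => /spoke_face <- nf; case: nf.
by case: b; rewrite /= /dart_face ?left_face_prev.
Qed.

Let bcl_df x y : link_class (@bface G) (~: bkept) x =
  link_class (@bface G) (~: bkept) y ->
  df x = df y.
Proof.
move/class_eqP/connectP=> [p]; elim: p x => [|z p IH] x /=;
  first by move=> _ ->.
case/andP=> /existsP[d /and3P[dK /eqP <- /eqP dz]] pz /(IH _ pz) <-;
  rewrite -dz.
case: d dK {dz} => [[e|d] b] /=; rewrite in_setC in_set => dK.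
  by rewrite -[(e, ~~ b)]/(rev ((e, b) : dart G)) dart_face_rev.
by case: b; rewrite /dart_face /= left_face_prev.
Qed.

(** The kept spokes all lie in the outside face, so away from it merging the triangles of the
    subdivision amounts to merging the faces of [G]. *)
Let df_bcl x y : df x <> oface -> df x = df y ->
  link_class (@bface G) (~: bkept) x = link_class (@bface G) (~: bkept) y.
Proof.
have sym := @connect_link_sym _ _ (@bface G) (~: bkept).
have same u v : df u <> oface -> left_face u = left_face v ->
    connect (link (@bface G) (~: bkept)) u v.
  move=> nu /left_faceP/connectP[p]; elim: p u nu => [|z p IH] u nu /=.
    by move=> _ ->.
  case/andP=> /eqP <- pz pv; apply: connect_trans (IH _ _ pz pv); last first.
    by rewrite /dart_face -left_face_prev face_nextK.
  rewrite sym; have := @linkI _ _ (@bface G) (~: bkept)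
    (inr (face_next u), false).
  rewrite /= face_nextK => H; apply/connect1/H; rewrite in_setC in_set.
  apply/negP=> /spoke_face; rewrite /dart_face -left_face_prev face_nextK.
  exact: nu.
move=> nx /merged_faceP/connectP[p xp yp]; apply/class_eqP.
elim: p x nx xp yp => [|c p IH] x nx /=.
  by move=> _ E; apply: same.
case/andP=> /existsP[d /and3P[dl /eqP dx /eqP dc]] cp yp.
have nd : df d <> oface by rewrite /dart_face dx.
apply: connect_trans (same x d nx (esym dx)) _.
have dd : connect (link (@bface G) (~: bkept)) d (rev d).
  have := @linkI _ _ (@bface G) (~: bkept) (old_dart d).
  rewrite /= in_setC -[inl _ \in _]/(dart_in bkept (old_dart d)) dart_in_old.
  by move=> /(_ dl); case: (d) => ? ?; apply: connect1.
apply: connect_trans dd (IH (rev d) _ _ _); rewrite ?dc //.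
by rewrite dart_face_rev.
Qed.

Let rot_inj : injective (rot G) := @perm_inj _ (rot G).

Let iter_base m y : base (iter m (rot G) y) = base y.
Proof. by elim: m => //= m <-; rewrite base_rot. Qed.

Let dart_face_walk y j : (forall i, i < j ->
  (iter i.+1 (rot G) y).1 \notin lv) ->
  df (iter j.+1 (rot G) y) = df (rev y).
Proof.
elim: j => [|j IH] nl; rewrite iterS dart_face_rot //.
by rewrite dart_face_rev ?IH // => [i lt|]; apply: nl; first exact: ltnW.
Qed.

(** No kept spoke comes between two consecutive live darts here: a transit vertex bears none, and a
    spoke in the corner would put that corner in the outside face. *)
Let bnx_old y : y.1 \in lv ->
  base y \in transit L T \/ df (live_next L T y) <> oface ->
  bnx (old_dart y) = old_dart (live_next L T y).
Proof.
move=> yl H; rewrite live_nextE in H *.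
have [m [mE ml nm]] := @first_returnP _ (rot G) (fun x => x.1 \in lv) rot_inj y
  yl.
have nspoke i : i <= m ->
    ((iter i.+1 (rot G) y \in spokeL) || (iter i.+1 (rot G) y \in spokeT)) =
      false.
  move=> le; case: H => [yt|nf].
    by apply: spoke_transit; rewrite iter_base.
  apply/negP=> /spoke_face sf; case: nf; rewrite mE -sf.
  rewrite !dart_face_walk // => j lt; apply: nm; exact: leq_trans lt le.
rewrite mE -iter_brot_old doubleS; apply: (first_return_iter (@brot_inj G)).
- by rewrite dart_in_old.
- by rewrite -doubleS iter_brot_old dart_in_old.
move=> i lt; have [odi|evi] := boolP (odd i).
  have -> : i.+1 = i./2.+1.*2 by rewrite doubleS -[in LHS](odd_double_half i)
    odi.
  by rewrite iter_brot_old dart_in_old; apply: nm; lia.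
have -> : i = i./2.*2 by rewrite -[in LHS](odd_double_half i) (negPf evi).
by rewrite iterS_brot_old dart_in_spoke nspoke //; lia.
Qed.

Variables (R : comPzRingType) (w : edge G -> R).
Local Notation X := (resolution w L T).

(** At a vertex that is both a left and a right endpoint the new edge keeps the sign +, for it has
    to contribute 1, the weight of the path of length zero. *)
Definition resolution_sign (e : bg_edge X) : bool :=
  match e with inl _ => false | inr p => sval p \in transit L T end.

Definition corner v b : pred (dart G) := fun x =>
  [&& x.1 \in lv, base x == v, x.2 == b & (live_next L T x).2 == ~~ b].

Let new_faceE v b : new_face L T v b <> oface ->
  exists2 x, [pick x | corner v b x] = Some x /\ corner v b x &
     df (live_next L T x) = new_face L T v b.
Proof.
rewrite /new_face -/(corner v b).
by case: pickP => // x cx _; exists x.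
Qed.

Let live_next_in y : y.1 \in lv -> (live_next L T y).1 \in lv.
Proof. exact: (@first_return_in _ _ (fun x => x.1 \in lv) rot_inj). Qed.

Let base_live_next y : y.1 \in lv -> base (live_next L T y) = base y.
Proof.
move=> yl; have [m [mE _ _]] := @first_returnP _ (rot G) (fun x => x.1 \in lv)
  rot_inj y yl.
by rewrite live_nextE mE iter_base.
Qed.

Let dart_face_live_next y : y.1 \in lv -> df (live_next L T y) = df (rev y).
Proof.
move=> yl; have [m [mE _ nm]] := @first_returnP _ (rot G) (fun x => x.1 \in lv)
  rot_inj y yl.
by rewrite live_nextE mE dart_face_walk.
Qed.

Let corner_transit y : y.1 \in lv -> y.2 != (live_next L T y).2 ->
  base y \in transit L T.
Proof.
move=> yl; have nl := live_next_in yl; have nb := base_live_next yl.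
move=> ne; apply: live_transit => //; apply: contraNN ne => yb.
  by rewrite (live_L yl yb) (live_L nl) // nb.
by rewrite (live_T yl yb) (live_T nl) // nb.
Qed.

Section Tight.
Hypothesis live_neq0 : lv != set0.

Let bkept_neq0 : bkept != set0.
Proof.
by case/set0Pn: live_neq0 => e el; apply/set0Pn; exists (inl e); rewrite in_set.
Qed.

Let edge_gt0 : 0 < #|edge G|.
Proof. by apply/card_gt0P; exists d0.1. Qed.

Let tight_corner v : #|out_in (@bbase G) (@brot G) bout bkept (inl v)| <= 1.
Proof.
have [h hP] := height.
exact: (@out_in_le1 _ _ _ (@bbase G) (@brot G) (@bface G) bout
  (@brot_inj G) (bbase_rot Gplanar) (brot_conn Gplanar) (@bface_rot G)
  (@bface_surj G) bout_flip (bmap_euler Gplanar edge_gt0) (bmap_connected Gconn)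
  bkept bkept_neq0 hub0 h hP b_in_and_out hub_out_in_le1).
Qed.

Let turn b v := if b then out_in (@bbase G) (@brot G) bout bkept (inl v)
  else in_out (@bbase G) (@brot G) bout bkept (inl v).

(** Such a corner is a passage at [v], and the index count allows only one of each kind; hence the
    [pick] in [new_face] is forced. *)
Lemma corner_uniq v b x y : v \in transit L T -> corner v b x -> corner v b y ->
  x = y.
Proof.
move=> vt cx cy; have E z : corner v b z -> old_dart z \in turn b v.
  case/and4P=> zl /eqP zv /eqP zb /eqP nb.
  have zo : bnx (old_dart z) = old_dart (live_next L T z).
    by apply: bnx_old => //; left; rewrite zv.
  have bz : bbase (old_dart z) = inl v by rewrite -zv; case: (z).
  rewrite /turn; case: (b) zb nb => zb nb;
    rewrite in_set dart_in_old zl bz eqxx zo /=.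
    by rewrite zb nb.
  by rewrite zb nb.
have le1 : #|turn b v| <= 1.
  rewrite /turn; case: (b); first exact: tight_corner.
  rewrite card_in_out ?tight_corner //; first exact: brot_inj.
  exact: bbase_rot.
have := card_le1_eqP le1 _ _ (E _ cx) (E _ cy).
by case: (x) => ? ?; case: (y) => ? ? [-> ->].
Qed.

(** The corners of a finite face avoid the hub, so [out_out_eq1] gives one source turn and
    [card_in_in] one sink turn; the other corners are passages. *)
Lemma card_face c0 : c0 <> oface -> (exists y, df y = c0) ->
  #|[set y : dart G | (y.1 \in lv) && (df y == c0)]| =
  #|[set y : dart G | [&& y.1 \in lv, df (live_next L T y) == c0
                        & y.2 != (live_next L T y).2]]| + 2.
Proof.
move=> nc [y0 y0c]; pose c := link_class (@bface G) (~: bkept) y0.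
have fc z : (link_class (@bface G) (~: bkept) z == c) = (df z == c0).
  apply/eqP/eqP => [/bcl_df->//|zc].
  by apply: df_bcl; rewrite zc // y0c.
have old_inj : injective (@old_dart G).
  by move=> [? ?] [? ?] [-> ->].
have old_face y : bface (old_dart y) = y by case: y.
have nohub d : dart_in bkept d -> bcl (bnx d) = c -> bbase d != hub0.
  move=> dK /eqP; rewrite fc => /eqP dc.
  have [||y yl yE] := @in_old (bnx d); first exact:
    (first_return_in (@brot_inj G)).
    by rewrite dc.
  rewrite -(base_next_dart (@brot_inj G) (bbase_rot Gplanar) dK).
  by rewrite yE.
have [h hP] := height.
have oo1 : #|out_out (@brot G) (@bface G) bout bkept c| = 1.
  exact: (@out_out_eq1 _ _ _ (@bbase G) (@brot G) (@bface G) bout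
  (@brot_inj G) (bbase_rot Gplanar) (brot_conn Gplanar) (@bface_rot G)
  (@bface_surj G) bout_flip (bmap_euler Gplanar edge_gt0) (bmap_connected Gconn)
  bkept bkept_neq0 hub0 h hP b_in_and_out hub_out_in_le1 c (mem_classes _ _ _)
    nohub).
have := card_face_class (@brot_inj G) (@bface_rot G) bout_flip bkept c.
rewrite oo1 => E; rewrite -[LHS](card_imset _ old_inj)
  -[X in X + 2](card_imset _ old_inj).
transitivity #|[set d | dart_in bkept d & bcl d == c]|.
  apply: eq_card => d; rewrite in_set; apply/imsetP/andP.
    case=> y; rewrite in_set => /andP[yl yc] ->; rewrite dart_in_old;
      split=> //.
    by rewrite /face_class fc old_face.
  case=> dK; rewrite /face_class fc => /eqP dc.
  have [|y yl dE] := in_old dK; first by rewrite dc.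
  by exists y; rewrite // in_set yl -dc dE old_face /=.
rewrite {}E; congr (_ + _); apply: eq_card => d; rewrite in_set.
apply/and3P/imsetP.
  case=> dK; rewrite (face_class_next (@brot_inj G) (@bface_rot G)) //.
  rewrite /face_class fc => /eqP dc.
  have [|z zl dE] := @in_old (flip d) dK; first by rewrite dc.
  have {dE} dE : d = old_dart (rev z) by rewrite -[d]flipK dE.
  have yl : (rev z).1 \in lv by [].
  have {}dc : df (live_next L T (rev z)) = c0.
    rewrite dart_face_live_next // revK -dc dE.
    by case: (z) => ? b; rewrite /= negbK.
  rewrite dE bnx_old //; last by right; rewrite dc.
  by move=> ne; exists (rev z); rewrite // in_set dc eqxx ne yl.
case=> y; rewrite in_set => /and3P[yl /eqP yc ne] ->.
rewrite bnx_old //; last by right; rewrite yc.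
by rewrite dart_in_old yl /face_class fc old_face yc eqxx.
Qed.

End Tight.
(** If a finite face has m passages, its boundary in the resolution has m + 2 old sides, of sign +,
    and m new sides, of sign -; and m is odd exactly when 4 divides 2m + 2. *)
Lemma resolution_sign_kasteleyn : @kasteleyn_signs R X resolution_sign.
Proof.
move=> D; rewrite -[bg_outer X]/oface; set c0 := bg_face D => nc.
have liveD : exists2 y, y.1 \in lv & df y = c0.
  rewrite /c0 in nc *; case: D @c0 nc => [[a|p] b] /= nc.
    by exists (sval a, b) => //; apply: (svalP a).
  have [x [_ /and4P[xl _ _ _]] xf] := new_faceE nc.
  by exists (live_next L T x); rewrite ?live_next_in.
have lv0 : lv != set0 by case: liveD => y yl _; apply/set0Pn; exists y.1.
have cf := card_face lv0 nc.
pose S := [set d : bg_edge X * bool | bg_face d == c0].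
pose N := [set d : bg_edge X * bool | (bg_face d == c0) && resolution_sign d.1].
have SN : #|S :\: N| = #|[set y : dart G | (y.1 \in lv) && (df y == c0)]|.
  pose g (d : bg_edge X * bool) : dart G :=
    match d with (inl a, b) => (sval a, b) | (inr _, _) => d0 end.
  have isold d : d \in S :\: N -> exists a : {e | e \in lv}, d = (inl a, d.2).
    case: d => [[a|p] b]; first by exists a.
    rewrite !in_set => /andP[nN dc]; rewrite dc /= in nN.
    have nf : new_face L T (sval p) b <> oface by move/eqP: dc => /= ->.
    have [x [_ /and4P[xl /eqP xb x2 nx2]] _] := new_faceE nf.
    case/negP: nN; rewrite -xb; apply: corner_transit => //.
    by rewrite (eqP x2) (eqP nx2); case: (b).
  rewrite -(card_in_imset (f := g)).
    apply: eq_card => y; rewrite in_set; apply/imsetP/andP.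
      case=> d dS; have [a dE] := isold d dS; rewrite dE /= => ->.
      split; first exact: (svalP a).
      by move: dS; rewrite dE !in_set => /andP[_].
    case: y => e b /= [el yc].
    exists ((inl (exist _ e el), b) : bg_edge X * bool) => //.
    by rewrite !in_set andbF /=.
  move=> d d' /isold[a ->] /isold[a' ->] /= [aa ->].
  by congr (inl _, _); apply: val_inj.
have NN : #|N| = #|[set y : dart G | [&& y.1 \in lv, df (live_next L T y) == c0
                        & y.2 != (live_next L T y).2]]|.
  (* A negative side is sent to the corner that [new_face] picks for it; [d0] only fills the cases
     that do not occur in [N]. *)
  pose g (d : bg_edge X * bool) : dart G :=
    match d with (inl _, _) => d0
    | (inr p, b) => odflt d0 [pick x | corner (sval p) b x] end.
  have isnew d : d \in N -> exists p, [/\ d =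
    (inr p, d.2), sval p \in transit L T,
      corner (sval p) d.2 (g d) & df (live_next L T (g d)) = c0].
    case: d => [[a|p] b]; rewrite !in_set /= ?andbF // => /andP[/eqP dc pt].
    have nf : new_face L T (sval p) b <> oface by rewrite dc.
    have [x [px cx] xf] := new_faceE nf.
    by exists p; rewrite /= px /= xf dc; split.
  rewrite -(card_in_imset (f := g)).
    apply: eq_card => y; rewrite in_set; apply/imsetP/and3P.
      case=> d dN ->; have [p [_ _ /and4P[xl _ x2 nx2] xf]] := isnew d dN.
      by rewrite xl xf eqxx (eqP x2) (eqP nx2); split=> //; case: d.2.
    case=> yl /eqP yc ne; have yt := corner_transit yl ne.
    have yB : (base y \in black_set L T) && (base y \in white_set L T).
      by rewrite !in_setU yt !orbT.
    have cy : corner (base y) y.2 y.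
      by rewrite /corner yl !eqxx /=; case: y.2 ne; case: (live_next _ _ _).2.
    have E0 : [pick x | corner (base y) y.2 x] = Some y.
      case: pickP => [x cx|/(_ y)]; last by rewrite cy.
      by rewrite (corner_uniq lv0 yt cx cy).
    exists (inr (exist _ (base y) yB), y.2); last by rewrite /= E0.
    by rewrite in_set /= yt andbT /new_face -/(corner _ _) E0 /= -yc.
  move=> d d' dN d'N; have [p [-> pt cp _]] := isnew d dN.
  have [p' [-> p't cp' _]] := isnew d' d'N => E0.
  rewrite E0 in cp; case/and4P: cp => _ /eqP bp /eqP b2 _.
  case/and4P: cp' => _ /eqP bp' /eqP b2' _.
  have db : d.2 = d'.2 by rewrite /= in b2 b2'; rewrite -b2 b2'.
  rewrite db; congr (inr _, _).
  by apply: val_inj; rewrite /= -bp bp'.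
have NS : N \subset S by apply/subsetP=> d; rewrite !in_set => /andP[].
have SE : #|S| = #|N| + (#|N| + 2).
  by rewrite -(cardsID N S) (setIidPr NS) SN NN cf //; case: liveD => y _ <-;
    exists y.
rewrite -/S -/N SE; move: #|N| => m; lia.
Qed.

End Signs.

(** * Elimination and path sums *)

Section Elimination.
Variable R : comPzRingType.
Local Open Scope ring_scope.

(** In blocks, [M] is (D B; C E) with D lower triangular of diagonal -1, and [X] solves D X + B = 0.
    Eliminating the first block leaves the Schur complement E + C X; giving [X] in advance avoids
    the inverse of D. *)
Lemma pivots_elim (m n p : nat) (M : 'M[R]_(m + n, m + p)) (X : 'M[R]_(m, p)) :
  (forall i, M (lshift n i) (lshift p i) = -1) ->
  (forall i j : 'I_m, (i < j)%N -> M (lshift n i) (lshift p j) = 0) ->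
  (forall i j, \sum_k M (lshift n i) (lshift p k) * X k j +
     M (lshift n i) (rshift m j) = 0) ->
  by_deleted_pivots (\matrix_(i < n, j < p)
    (M (rshift m i) (rshift m j) + \sum_k M (rshift m i) (lshift p k) * X k j))
      M.
Proof.
elim: m M X => [|m IH] M X diag tri sys.
  have -> : \matrix_(i < n, j < p) (M (rshift 0 i) (rshift 0 j) +
      \sum_k M (rshift 0 i) (lshift p k) * X k j) = M; last exact: dp_done.
  apply/matrixP=> i j; rewrite mxE big_ord0 addr0.
  by congr (M _ _); apply: val_inj.
pose z q : 'I_(m.+1 + q) := lshift q ord0.
pose c k := - M k (z p); pose r l := - M (z n) l.
pose M1 := \matrix_(k, l) if k == z n then M k l else M k l - c k * M (z n) l.
pose M2 := \matrix_(k, l) if l == z p then M1 k l else M1 k l - r l * M1 k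
  (z p).
have d0 : M (z n) (z p) = -1 := diag ord0.
have piv : pivot (z n) (z p) M M2.
  by exists c, r; split=> // [k|l]; rewrite d0 mulrN1 opprK.
apply: dp_pivot piv _.
have E i j : row' (z n) (col' (z p) M2) i j =
    M (lift (z n) i) (lift (z p) j) + M (lift (z n) i) (z p) * M (z n)
      (lift (z p) j).
  rewrite !mxE ![lift _ _ == _]eq_sym !(negPf (neq_lift _ _)) d0 /c /r.
  by rewrite !mulNr !opprK mulrN1 subrr mulr0 addr0.
have Ll q (i : 'I_m) : lift (z q) (lshift q i) =
  lshift q (lift ord0 i) by apply: val_inj.
have Lr q (i : 'I_q) : lift (z q) (rshift m i) = rshift m.+1 i by apply:
  val_inj.
pose M' : 'M[R]_(m + n, m + p) := row' (z n) (col' (z p) M2).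
pose X' : 'M[R]_(m, p) := \matrix_(k, j) X (lift ord0 k) j.
have row0 j : \sum_k M (z n) (lshift p (lift ord0 k)) * X (lift ord0 k) j +
    M (z n) (rshift _ j) = X ord0 j.
  have := sys ord0 j; rewrite big_ord_recl -/(z n) -/(z p) d0 mulN1r -addrA.
  by move/(canRL (addNKr _)); rewrite addr0.
have V_eq i j : \sum_k M' i (lshift p k) * X' k j + M' i (rshift m j) =
    \sum_k M (lift (z n) i) (lshift p k) * X k j +
      M (lift (z n) i) (rshift m.+1 j).
  rewrite big_ord_recl -row0 mulrDr mulr_sumr /M' E Lr.
  under eq_bigr do rewrite E Ll mxE mulrDl -mulrA.
  by rewrite big_split /= addrACA -[RHS]addrA [RHS]addrC.
have -> : \matrix_(i < n, j < p) (M (rshift m.+1 i) (rshift m.+1 j) +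
      \sum_k M (rshift m.+1 i) (lshift p k) * X k j) =
    \matrix_(i < n, j < p) (M' (rshift m i) (rshift m j) +
      \sum_k M' (rshift m i) (lshift p k) * X' k j).
  apply/matrixP=> i j; have := V_eq (rshift m i) j; rewrite Lr => E1.
  by rewrite [LHS]mxE [RHS]mxE addrC -E1 addrC.
have z0 (i : 'I_m) : M (z n) (lshift p (lift ord0 i)) = 0 by apply: tri.
apply: (IH M' X') => [i|i j ij|i j].
- by rewrite /M' E !Ll diag z0 mulr0 addr0.
- by rewrite /M' E !Ll z0 mulr0 addr0 tri.
by rewrite V_eq Ll sys.
Qed.

End Elimination.

(** * Cutting paths at selected vertices *)

Section Resolvent.
Variables (R : comPzRingType) (N n : nat).
Local Open Scope ring_scope.

(* With A the adjacency matrix of a graph and E selecting vertices, A1 is the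
   adjacency matrix once the edges into the selected vertices are removed: a
   path is cut at the last selected vertex that it visits. *)
Lemma resolvent_factor (A A1 P P1 : 'M[R]_N) (E : 'M[R]_(n, N)) :
  E *m E^T = 1%:M -> A1 = A - A *m (E^T *m E) ->
  P *m (1%:M - A) = 1%:M -> (1%:M - A1) *m P1 = 1%:M ->
  E *m P = (E *m P *m E^T) *m (E *m P1) /\
  exists C, (E *m P *m E^T) *m C = 1%:M /\ C *m (E *m P *m E^T) = 1%:M.
Proof.
move=> EE A1E PA A1P1.
have PAE : P *m A = P - 1%:M by rewrite -PA mulmxBr mulmx1 opprB addrC subrK.
have PE : P = P1 + P *m A *m (E^T *m E) *m P1.
  have PA1 : P *m (1%:M - A1) = 1%:M + P *m A *m (E^T *m E).
    by rewrite A1E opprD opprK addrA mulmxDr PA mulmxA.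
  by rewrite -[LHS]mulmx1 -A1P1 mulmxA PA1 mulmxDl mul1mx.
have fac : E *m P = (E *m P *m E^T) *m (E *m P1).
  rewrite {1}PE PAE mulmxDr !mulmxA mulmxBr mulmx1 !mulmxBl EE mul1mx.
  by rewrite addrC subrK.
split=> //; exists (1%:M - E *m P1 *m A *m E^T).
suff C1 : (E *m P *m E^T) *m (1%:M - E *m P1 *m A *m E^T) = 1%:M.
  by split=> //; apply: mulmx1C.
rewrite mulmxBr mulmx1 !mulmxA; rewrite !mulmxA in fac.
by rewrite -fac -(mulmxA E P A) PAE mulmxBr mulmx1 mulmxBl EE opprB addrC subrK.
Qed.

End Resolvent.

(** * Path sums as the inverse of I - A, for A the adjacency matrix *)

Section Paths.
Variables (R : comPzRingType) (G : embedded_digraph) (w : edge G -> R).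
Hypothesis Gacyc : acyclic G.
Local Open Scope ring_scope.
Local Notation N := #|vertex G|.
Implicit Types (K : pred (edge G)) (u v : vertex G).

Definition adj K : 'M[R]_N := \matrix_(i, j)
  \sum_(e | [&& K e, src e == enum_val i & dst e == enum_val j]) w e.

Definition path_sums K : 'M[R]_N := \sum_(l < N) adj K ^+ l.

Lemma adj_rank K u v : adj K (enum_rank u) (enum_rank v) =
  \sum_(e | [&& K e, src e == u & dst e == v]) w e.
Proof. by rewrite mxE !enum_rankK. Qed.

Lemma sum_rank (F : 'I_N -> R) : \sum_i F i =
  \sum_(v : vertex G) F (enum_rank v).
Proof. by rewrite (reindex _ (onW_bij _ (enum_rank_bij _))). Qed.

Lemma adj_mulE K (Y : 'M[R]_N) u j : (adj K *m Y) (enum_rank u) j =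
  \sum_(e | K e && (src e == u)) w e * Y (enum_rank (dst e)) j.
Proof.
rewrite mxE sum_rank; under eq_bigr do rewrite adj_rank mulr_suml.
rewrite [RHS](partition_big (@dst G) predT) //=; apply: eq_bigr => v _.
by apply: eq_big => [e|e /and3P[_ _ /eqP->]] //; rewrite -andbA.
Qed.

(** A path of l edges raises the height by at least l, and heights lie between 1 and [N]. *)
Lemma adj_nilp K : adj K ^+ N = 0.
Proof.
have [h [hlt hN]] := acyclic_height Gacyc.
have H l u j : (h (enum_val j) < h u + l)%N -> (adj K ^+ l) (enum_rank u) j = 0.
  elim: l u => [|l IH] u lt.
    by rewrite expr0 mxE; case: eqP lt => // <-; rewrite enum_rankK addn0 ltnn.
  rewrite exprS -mulmxE adj_mulE big1 // => e /andP[_ /eqP eu].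
  by rewrite IH ?mulr0 //; have := hlt e; rewrite eu; lia.
apply/matrixP=> i j; rewrite -[i]enum_valK H ?mxE //.
have /andP[hi _] := hN (enum_val i); have /andP[_ hj] := hN (enum_val j).
by apply: leq_ltn_trans hj _; rewrite -[X in (X < _)%N]add0n ltn_add2r.
Qed.

Lemma path_sums_l K : (1%:M - adj K) *m path_sums K = 1%:M.
Proof.
have := GRing.subrX1 (adj K) N; rewrite adj_nilp sub0r => E.
by apply: oppr_inj; rewrite -mulNmx opprB; apply: esym E.
Qed.

Lemma path_sums_r K : path_sums K *m (1%:M - adj K) = 1%:M.
Proof. exact/mulmx1C/path_sums_l. Qed.

Lemma path_sums_rec K u j : path_sums K (enum_rank u) j =
  (enum_rank u == j)%:R +
  \sum_(e | K e && (src e == u)) w e * path_sums K (enum_rank (dst e)) j.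
Proof.
have := congr1 (fun M : 'M_N => M (enum_rank u) j) (path_sums_l K).
rewrite mulmxBl mul1mx -adj_mulE !mxE => /(canRL (subrK _)) ->.
by [].
Qed.

Lemma adj_pow_tuple l u v : (adj predT ^+ l) (enum_rank u) (enum_rank v) =
  \sum_(p : l.-tuple (edge G) | dipath u v p) \prod_(e <- p) w e.
Proof.
elim: l u => [|l IH] u.
  rewrite expr0 mxE (inj_eq enum_rank_inj).
  rewrite (eq_bigl (fun=> u == v)) => [|p]; last by rewrite [p]tuple0.
  case: eqP => _; last by rewrite big_pred0_eq.
  by rewrite (big_pred1 [tuple]) ?big_nil // => p; apply/esym/eqP; apply:
    tuple0.
rewrite exprS -mulmxE adj_mulE.
under eq_bigr do rewrite IH mulr_sumr.
rewrite pair_big_dep /=.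
rewrite [RHS](reindex (fun x : edge G * l.-tuple
  (edge G) => [tuple of x.1 :: x.2])) /=.
  by apply: eq_big => [x|x _] //; rewrite big_cons.
exists (fun t : l.+1.-tuple (edge G) => (thead t, [tuple of behead t])) =>
  [x _|t _].
  by case: x => e t; rewrite theadE /=; congr (_, _); apply: val_inj.
by rewrite /= -tuple_eta.
Qed.

Lemma gessel_viennotE n (lend rend : 'I_n -> vertex G) :
  gessel_viennot w lend rend = \matrix_(i, j)
    path_sums predT (enum_rank (lend i)) (enum_rank (rend j)).
Proof.
apply/matrixP=> i j; rewrite !mxE summxE; apply: eq_bigr => l _.
by rewrite adj_pow_tuple.
Qed.

End Paths.

(** * Selection matrices *)

Section Selection.
Variables (R : comPzRingType) (N n : nat) (f : 'I_n -> 'I_N).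
Hypothesis f_inj : injective f.
Local Open Scope ring_scope.

Definition select : 'M[R]_(n, N) := rowsub f 1%:M.

Lemma select_mul p (Y : 'M[R]_(N, p)) : select *m Y = rowsub f Y.
Proof. by rewrite [RHS]rowsubE. Qed.

Lemma mul_select p (Y : 'M[R]_(p, N)) : Y *m select^T = colsub f Y.
Proof.
by apply: trmx_inj; rewrite trmx_mul trmxK select_mul trmx_mxsub.
Qed.

Lemma select_selectT : select *m select^T = 1%:M.
Proof. by apply/matrixP=> i j; rewrite mul_select !mxE (inj_eq f_inj). Qed.

Lemma mul_selectT_select p (A : 'M[R]_(p, N)) i j :
  (A *m (select^T *m select)) i j = if j \in codom f then A i j else 0.
Proof.
rewrite mulmxA mul_select mxE; under eq_bigr do rewrite !mxE.
case: ifP => [/codomP[k ->]|jf].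
  rewrite (bigD1 k) //= eqxx mulr1 big1 ?addr0 // => l lk.
  by rewrite (inj_eq f_inj) (negPf lk) mulr0.
rewrite big1 // => k _; case: eqP => [fk|]; last by rewrite mulr0.
by rewrite -fk codom_f in jf.
Qed.

End Selection.

(** * The two invertible factors *)

Section Reduction.
Variables (R : comPzRingType) (G : embedded_digraph) (w : edge G -> R).
Hypothesis Gacyc : acyclic G.
Variables (n : nat) (lend rend : 'I_n -> vertex G).
Hypotheses (lend_inj : injective lend) (rend_inj : injective rend).
Local Open Scope ring_scope.
Local Notation L := [set lend i | i : 'I_n].
Local Notation T := [set rend j | j : 'I_n].

Let frank (f : 'I_n -> vertex G) i := enum_rank (f i).

Let frank_inj (f : 'I_n -> vertex G) : injective f -> injective (frank f).
Proof. by move=> f_inj i j /enum_rank_inj/f_inj. Qed.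

Let codom_frank (f : 'I_n -> vertex G) k :
  (k \in codom (frank f)) = (enum_val k \in [set f i | i : 'I_n]).
Proof.
apply/codomP/imsetP => [[i ->]|[i _ E]]; exists i; rewrite ?enum_rankK //.
by rewrite /frank -E enum_valK.
Qed.

Let adj_cut_dst (K : pred (edge G)) : adj w (fun e => K e && (dst e \notin L)) =
  adj w K - adj w K *m ((select R (frank lend))^T *m select R (frank lend)).
Proof.
apply/matrixP=> i j; rewrite [RHS]mxE [X in _ = _ + X]mxE mul_selectT_select;
  last exact: frank_inj.
rewrite codom_frank [LHS]mxE; case: ifP => jL.
  rewrite subrr big_pred0 // => e; apply/negP=> /and3P[/andP[_ dL] _ /eqP dj].
  by rewrite dj jL in dL.
rewrite subr0 mxE; apply: eq_bigl => e.
have [E0|_] := (dst e =P enum_val j); rewrite ?andbF // !andbT.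
by rewrite E0 jL andbT.
Qed.

Let adj_cut_src (K : pred (edge G)) :
  (adj w (fun e => K e && (src e \notin T)))^T =
  (adj w K)^T - (adj w K)^T *m ((select R (frank rend))^T *m select R
    (frank rend)).
Proof.
apply/matrixP=> i j; rewrite [RHS]mxE [X in _ = _ + X]mxE mul_selectT_select;
  last exact: frank_inj.
rewrite codom_frank [LHS]mxE [LHS]mxE; case: ifP => jT.
  rewrite subrr big_pred0 // => e; apply/negP=> /and3P[/andP[_ sT] /eqP sj _].
  by rewrite sj jT in sT.
rewrite subr0 !mxE; apply: eq_bigl => e.
have [E0|_] := (src e =P enum_val j); rewrite ?andbF //= E0 jT.
by rewrite andbT.
Qed.

Definition kept_matrix : 'M[R]_n := \matrix_(i, j)
  path_sums w (kept L T) (enum_rank (lend i)) (enum_rank (rend j)).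

(** Apply [resolvent_factor] twice: in [G] at the left endpoints, then, without the edges into left
    endpoints and on transposed matrices (the reversed graph), at the right endpoints. *)
Lemma gessel_viennot_kept : exists A B A' B' : 'M[R]_n,
  [/\ A *m A' = 1%:M, A' *m A = 1%:M, B *m B' = 1%:M, B' *m B = 1%:M
    & gessel_viennot w lend rend = A *m kept_matrix *m B].
Proof.
pose K1 e := predT e && (dst e \notin L).
pose EL := select R (frank lend); pose ET := select R (frank rend).
have tr1 : (1%:M : 'M[R]_#|vertex G|) = 1%:M^T by rewrite trmx1.
have [fL [A' [AA' A'A]]] := resolvent_factor
  (select_selectT R (frank_inj lend_inj))
  (adj_cut_dst predT) (path_sums_r w Gacyc predT) (path_sums_l w Gacyc K1).
have [||fT [B' [BB' B'B]]] := @resolvent_factor _ _ _ _ _ (path_sums w K1)^T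
  (path_sums w (fun e => K1 e && (src e \notin T)))^T _
  (select_selectT R (frank_inj rend_inj)) (adj_cut_src K1).
- by rewrite {1}tr1 -linearB -trmx_mul path_sums_l // trmx1.
- by rewrite {1}tr1 -linearB -trmx_mul path_sums_r // trmx1.
(* The factors are the path sums between left endpoints in [G], and those between right endpoints
   once the edges into left endpoints are gone. *)
exists (EL *m path_sums w predT *m EL^T), (ET *m (path_sums w K1)^T *m ET^T)^T,
  A', B'^T.
split=> //; try by rewrite -trmx_mul ?BB' ?B'B trmx1.
have -> : gessel_viennot w lend rend = EL *m path_sums w predT *m ET^T.
  by rewrite gessel_viennotE // select_mul mul_select; apply/matrixP=> i j;
    rewrite !mxE.
have -> : kept_matrix = EL *m path_sums w (fun e => K1 e && (src e \notin T)) *m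
  ET^T.
  by rewrite select_mul mul_select; apply/matrixP=> i j; rewrite !mxE.
have {}fT : path_sums w K1 *m ET^T =
    path_sums w (fun e => K1 e && (src e \notin T)) *m ET^T *m
      (ET *m (path_sums w K1)^T *m ET^T)^T.
  apply: trmx_inj; rewrite [LHS]trmx_mul [RHS]trmx_mul.
  by rewrite [X in _ = _ *m X]trmx_mul !trmxK.
have -> : EL *m path_sums w predT *m ET^T =
    (EL *m path_sums w predT *m EL^T) *m (EL *m (path_sums w K1 *m ET^T)).
  by rewrite {1}fL -!mulmxA.
by rewrite fT !mulmxA.
Qed.

End Reduction.

(** * Path sums along live edges *)

Section Live.
Variables (R : comPzRingType) (G : embedded_digraph) (w : edge G -> R).
Variables (L T : {set vertex G}).
Hypothesis Gacyc : acyclic G.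
Local Open Scope ring_scope.
Local Notation lv := (live L T).
Local Notation P := (path_sums w (kept L T)).

Lemma pruneS (S S' : {set vertex G}) : S \subset S' ->
  prune L T S \subset prune L T S'.
Proof.
move=> /subsetP sS; apply/subsetP=> v; rewrite !inE => /andP[/sS-> /=].
case/orP=> [->//|/andP[/existsP[e /and3P[ke ev /sS se]]]].
case/existsP=> [e' /and3P[ke' ev' /sS de]]; apply/orP; right; apply/andP.
by split; apply/existsP; [exists e; rewrite ke ev|exists e'; rewrite ke' ev'].
Qed.

(** [alive] iterates a monotone operator down from the full set, so it contains every set from which
    pruning removes nothing. *)
Lemma alive_max (S : {set vertex G}) : S \subset prune L T S ->
  S \subset alive L T.
Proof.
move=> sS; rewrite /alive; elim: #|_| => [|k IH] /=; first exact: subsetT.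
exact: subset_trans sS (pruneS IH).
Qed.

Lemma endpoint_alive v : v \in L :|: T -> v \in alive L T.
Proof.
move: v; apply/subsetP/alive_max/subsetP=> v vLT.
by rewrite in_set vLT.
Qed.

Definition kept_rel : rel (vertex G) := fun u v =>
  [exists e, [&& kept L T e, src e == u & dst e == v]].

Lemma path_sums_eq0 u v : ~~ connect kept_rel u v ->
  P (enum_rank u) (enum_rank v) = 0.
Proof.
move=> nuv; rewrite summxE big1 // => l _; elim:
  {l}(l : nat) u nuv => [|l IH] u nuv.
  rewrite expr0 mxE; case: eqP => // /enum_rank_inj uv.
  by rewrite uv connect0 in nuv.
rewrite exprS -mulmxE adj_mulE big1 // => e /andP[ke eu].
rewrite IH ?mulr0 //; apply: contraNN nuv; apply: connect_trans.
by apply/connect1/existsP; exists e; rewrite ke eu eqxx.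
Qed.

(** Adding to [alive] the vertices between [dst e] and [t] gives a set that pruning preserves, so
    [alive_max] applies. *)
Lemma alive_between e t : kept L T e -> src e \in alive L T -> t \in T ->
  connect kept_rel (dst e) t -> dst e \in alive L T.
Proof.
move=> ke se tT et.
pose S := alive L T :|: [set x | connect kept_rel (dst e) x &&
  connect kept_rel x t].
suff /alive_max/subsetP : S \subset prune L T S.
  by apply; rewrite !inE connect0 et orbT.
apply/subsetP=> x; rewrite in_setU => /orP[xa|].
  by apply/(subsetP (pruneS (subsetUl _ _))); rewrite prune_alive.
rewrite inE => /andP[ex xt].
have xS : x \in S by rewrite !inE ex xt orbT.
rewrite inE xS /=; apply/orP; have [xLT|nLT] := boolP (x \in L :|: T);
  [by left|right].
apply/andP; split.
  have [exE|ne] := eqVneq (dst e) x.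
    by apply/existsP; exists e; rewrite ke exE eqxx !inE se.
  case/connectP: ex => p; case/lastP: p => [_ xE|p y];
    first by rewrite xE eqxx in ne.
  rewrite rcons_path last_rcons => /andP[pp pl] xE; rewrite -{}xE in pl.
  have [f /and3P[kf /eqP sf df]] := existsP pl.
  apply/existsP; exists f; rewrite kf df sf in_setU in_set; apply/orP; right.
  apply/andP; split; first by apply/connectP; exists p.
  exact: connect_trans (connect1 pl) xt.
case/connectP: (xt) => [[|y p]] /=.
  by move=> _ xE; rewrite in_setU -xE tT orbT in nLT.
case/andP=> xy py tE; have [f /and3P[kf sf /eqP df]] := existsP xy.
apply/existsP; exists f; rewrite kf sf df in_setU in_set; apply/orP; right.
apply/andP; split; first exact: connect_trans ex (connect1 xy).
by apply/connectP; exists p.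
Qed.

(** A kept edge from a surviving vertex to a deleted one leads to no right endpoint, so the
    recursion on the first edge may be restricted to live edges. *)
Lemma path_sums_live u t : u \in alive L T -> t \in T ->
  P (enum_rank u) (enum_rank t) = (u == t)%:R +
  \sum_(e | (e \in lv) && (src e == u)) w e * P (enum_rank (dst e))
    (enum_rank t).
Proof.
move=> ua tT; rewrite path_sums_rec // (inj_eq enum_rank_inj); congr (_ + _).
rewrite (bigID (fun e => dst e \in alive L T)) /= [X in _ + X]big1 ?addr0.
  apply: eq_bigl => e; rewrite in_set; case: (src e =P u) => [->|_];
    last by rewrite !andbF.
  by rewrite ua !andbT.
move=> e /andP[/andP[ke /eqP eu] nd]; rewrite path_sums_eq0 ?mulr0 //.
by apply: contraNN nd; apply: alive_between; rewrite ?eu.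
Qed.

Lemma path_sums_right u t : u \in T -> P (enum_rank u) (enum_rank t) =
  (u == t)%:R.
Proof.
move=> uT; rewrite path_sums_rec // (inj_eq enum_rank_inj) big1 ?addr0 // => e.
by rewrite /kept => /andP[/andP[_ sT] /eqP eu]; rewrite eu uT in sT.
Qed.

Definition resolution_entry u v : R :=
  \sum_(e | (e \in lv) && ((src e == u) && (dst e == v))) w e +
  (if (u == v) && ((u \in black_set L T) && (u \in white_set L T))
   then (-1) ^+ (u \in transit L T) else 0).

(** Both cases are the recursion [path_sums_live]: the transit targets give the sum, and the other
    targets are right endpoints, where path sums are 0 or 1. If [u] is transit, its new edge has
    entry -1 and cancels the whole. Transit rows thus give the system required by [pivots_elim],
    left endpoints the entries of the result. *)
Lemma resolution_entry_sum u t : u \in black_set L T -> t \in T ->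
  \sum_(p in transit L T) resolution_entry u p * P (enum_rank p) (enum_rank t) +
  resolution_entry u t =
  if u \in transit L T then 0 else P (enum_rank u) (enum_rank t).
Proof.
move=> uB tT; have ua : u \in alive L T.
  move: uB; rewrite in_setU => /orP[uL|]; last by rewrite inE => /andP[].
  by apply: endpoint_alive; rewrite in_setU uL.
have -> : \sum_(p in transit L T) resolution_entry u p * P (enum_rank p)
  (enum_rank t) =
   \sum_(e | ((e \in lv) && (src e == u)) && (dst e \in transit L T))
      w e * P (enum_rank (dst e)) (enum_rank t) -
   (if u \in transit L T then P (enum_rank u) (enum_rank t) else 0).
  rewrite [in RHS](partition_big (@dst G) (mem (transit L T))) /=;
    last by move=> e /andP[].
  under eq_bigr do rewrite mulrDl.
  rewrite big_split /=; congr (_ + _).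
    apply: eq_bigr => p pt; rewrite mulr_suml; apply:
      eq_big => [e|e /and3P[_ _ /eqP->]] //.
    by case: (dst e =P p) => [->|_]; rewrite ?andbF // pt !andbT.
  case: ifP => ut; last first.
    rewrite big1 ?oppr0 // => p pt; case: eqP => [up|_]; last by rewrite mul0r.
    by rewrite up pt in ut.
  rewrite (bigD1 u) //= eqxx uB in_setU ut orbT expr1 mulN1r big1 ?addr0
    // => p.
  by case/andP=> _ pu; rewrite eq_sym (negPf pu) mul0r.
have -> : resolution_entry u t = (u == t)%:R +
    \sum_(e | ((e \in lv) && (src e == u)) && (dst e \notin transit L T))
      w e * P (enum_rank (dst e)) (enum_rank t).
  rewrite addrC; congr (_ + _).
    rewrite [RHS](eq_bigr (fun e => if dst e == t then w e else 0)); last first.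
      move=> e /andP[/andP[/live_ends[_]]]; rewrite in_setU => + _ nt.
      rewrite (negPf nt) orbF => dT; rewrite path_sums_right //.
      by case: eqP => _; rewrite ?mulr1 ?mulr0.
    rewrite -big_mkcondr; apply: eq_bigl => e.
    case: (dst e =P t) => [->|_]; rewrite ?andbF // !andbT.
    by case: (boolP (t \in transit L T)) => [/transit_notin|_];
      rewrite ?tT ?andbF ?andbT.
  case: eqP => [ut|_] //=; rewrite uB ut in_setU tT /=.
  by case: (boolP (t \in transit L T)) => [/transit_notin|_];
    rewrite ?tT ?andbF.
rewrite addrAC addrCA.
rewrite -[X in _ + X - _](bigID (fun e => dst e \in transit L T))
  -path_sums_live //.
by case: ifP => _; rewrite ?subrr ?subr0.
Qed.

End Live.

(** * Elimination of the transit vertices *)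

Section Assembly.
Variables (R : comPzRingType) (G : embedded_digraph) (w : edge G -> R).
Hypothesis Gacyc : acyclic G.
Variables (n : nat) (lend rend : 'I_n -> vertex G).
Hypotheses (lend_inj : injective lend) (rend_inj : injective rend).
Local Open Scope ring_scope.
Local Notation L := [set lend i | i : 'I_n].
Local Notation T := [set rend j | j : 'I_n].
Local Notation X := (resolution w L T).

Lemma resolution_entryE (b : bg_black X) (c : bg_white X) :
  \sum_(e : bg_edge X | (bg_bend e == b) && (bg_wend e == c))
    (-1) ^+ resolution_sign e * bg_weight e =
  resolution_entry w L T (sval b) (sval c).
Proof.
rewrite big_sumType /=; congr (_ + _).
  under eq_bigr do rewrite expr0 mul1r.
  rewrite big_mkcond [RHS]big_mkcondr [RHS](big_sub (live L T)).
  by apply: eq_bigr => a _; rewrite -!val_eqE.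
case: ifP => [/andP[/eqP bc bBW]|nbc].
  rewrite (big_pred1 (exist _ (sval b) bBW)) /= ?mulr1 // => p.
  by rewrite -!val_eqE /= -bc andbb.
rewrite big_pred0 // => p; rewrite -!val_eqE /=;
  apply/negP=> /andP[/eqP pb /eqP pc].
by case: p pb pc => v /= vBW vb vc; rewrite -vb -vc eqxx vBW in nbc.
Qed.

Lemma by_deleted_pivots_cast m k p q p' q' (V : 'M[R]_(m, k)) (M : 'M[R]_(p, q))
    (eqs : (p = p') * (q = q')) :
  by_deleted_pivots V (castmx eqs M) -> by_deleted_pivots V M.
Proof. by case: eqs => e e'; case: p' / e; case: q' / e';
  rewrite castmx_id. Qed.

(* The transit vertices come first, by decreasing height, so that no edge leads
   from one of them to a later one. *)
Lemma resolution_pivots : exists M : 'M[R]_(#|bg_black X|, #|bg_white X|),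
  (exists rho gam, [/\ bijective rho, bijective gam &
    M = \matrix_(i, j)
      \sum_(e : bg_edge X | (bg_bend e == rho i) && (bg_wend e == gam j))
        (-1) ^+ resolution_sign e * bg_weight e]) /\
  by_deleted_pivots (kept_matrix w lend rend) M.
Proof.
have [h [hlt _]] := acyclic_height Gacyc.
pose s := sort (fun u v => (h v <= h u)%N) (enum (transit L T)).
have us : uniq s by rewrite sort_uniq enum_uniq.
have ms v : (v \in s) = (v \in transit L T) by rewrite mem_sort mem_enum.
pose tau := tnth (in_tuple s).
have tau_transit i : tau i \in transit L T by rewrite -ms mem_tnth.
have tau_inj : injective tau by apply/tuple_uniqP.
have tau_sorted (i j : 'I_(size s)) : (i < j)%N -> (h (tau j) <= h (tau i))%N.
  move=> ij; have := sort_sorted (fun u v => leq_total (h v) (h u))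
    (enum (transit L T)).
  have htr : transitive (fun u v => (h v <= h u)%N) by move=> ? ? ? /[swap];
    apply: leq_trans.
  have x0 := tau i; move=> /(sorted_ltn_nth htr x0)/(_ i j).
  by rewrite !inE /tau !(tnth_nth x0); apply.
have tr_notin v : v \in transit L T -> (v \notin L) && (v \notin T) by apply:
  transit_notin.
(* Rows and columns list the transit vertices in the same order, which puts their new edges on the
   diagonal. *)
pose vert (f : 'I_n -> vertex G) (i : 'I_(size s + n)) :=
  match split i with inl k => tau k | inr j => f j end.
have vertl f k : vert f (lshift n k) = tau k by rewrite /vert
  (unsplitK (inl _ k)).
have vertr f k : vert f (rshift (size s) k) =
  f k by rewrite /vert (unsplitK (inr _ k)).
have vert_inj f : injective f -> (forall i, f i \notin transit L T) ->
  injective (vert f).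
  move=> f_inj ft i j.
  have [k -> | k ->] := split_ordP i; have [l -> | l ->] := split_ordP j;
    rewrite ?vertl ?vertr.
  - by move/tau_inj->.
  - by move=> E; have := ft l; rewrite -E tau_transit.
  - by move=> E; have := ft k; rewrite E tau_transit.
  - by move/f_inj->.
have vert_in (f : 'I_n -> vertex G) i : vert f i \in [set f i | i : 'I_n] :|:
  transit L T.
  by have [k -> | k ->] := split_ordP i;
    rewrite in_setU ?vertl ?vertr ?tau_transit ?imset_f ?orbT.
have card_vert (f : 'I_n -> vertex G) : injective f ->
  (forall i, f i \notin transit L T) ->
    #|[set f i | i : 'I_n] :|: transit L T| = (size s + n)%N.
  move=> f_inj ft; rewrite cardsU card_imset // card_ord addnC.
  rewrite size_sort -cardE; set I := _ :&: _; suff -> : I =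
    set0 by rewrite cards0 subn0.
  apply/setP=> v; rewrite !inE; apply/negP=> /andP[/imsetP[i _ ->]].
  by have := ft i; rewrite inE => /negPf->.
have lend_ntr i : lend i \notin transit L T.
  by apply/negP=> /tr_notin; rewrite imset_f.
have rend_ntr i : rend i \notin transit L T.
  by apply/negP=> /tr_notin; rewrite imset_f ?andbF.
have eB : #|bg_black X| = (size s + n)%N by rewrite card_sig card_vert.
have eW : #|bg_white X| = (size s + n)%N by rewrite card_sig card_vert.
pose rho i : bg_black X := exist _ (vert lend (cast_ord eB i)) (vert_in lend _).
pose gam i : bg_white X := exist _ (vert rend (cast_ord eW i)) (vert_in rend _).
pose M : 'M[R]_(#|bg_black X|, #|bg_white X|) := \matrix_(i, j)
      \sum_(e : bg_edge X | (bg_bend e == rho i) && (bg_wend e == gam j))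
        (-1) ^+ resolution_sign e * bg_weight e.
exists M; split.
  exists rho, gam; split=> //; apply: inj_card_bij; rewrite ?card_ord // => i j.
    by move/(congr1 val)/vert_inj => H; apply/(cast_ord_inj (eq_n := eB))/H.
  by move/(congr1 val)/vert_inj => H; apply/(cast_ord_inj (eq_n := eW))/H.
apply: (by_deleted_pivots_cast (eqs := (eB, eW))); set M' := castmx _ _.
have M'E i j : M' i j = resolution_entry w L T (vert lend i) (vert rend j).
  by rewrite castmxE mxE resolution_entryE /= !cast_ordKV.
pose Y : 'M[R]_(size s, n) := \matrix_(k, j)
  path_sums w (kept L T) (enum_rank (tau k)) (enum_rank (rend j)).
have sum_tau (u : vertex G) j :
    \sum_k resolution_entry w L T u (tau k) * Y k j =
    \sum_(p in transit L T) resolution_entry w L T u p *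
      path_sums w (kept L T) (enum_rank p) (enum_rank (rend j)).
  under eq_bigr do rewrite mxE.
  rewrite -(big_tnth _ _ s xpredT (fun p => resolution_entry w L T u p *
    path_sums w (kept L T) (enum_rank p) (enum_rank (rend j)))).
  by rewrite big_uniq //=; apply: eq_bigl => p; rewrite ms.
have in_black i : vert lend i \in black_set L T by apply: vert_in.
have -> : kept_matrix w lend rend = \matrix_(i < n, j < n)
    (M' (rshift (size s) i) (rshift (size s) j) +
     \sum_k M' (rshift (size s) i) (lshift n k) * Y k j).
  apply/matrixP=> i j; rewrite mxE [RHS]mxE addrC M'E !vertr.
  under eq_bigr do rewrite M'E vertr vertl.
  rewrite sum_tau resolution_entry_sum // ?imset_f //;
    last by rewrite -(vertr lend).
  by rewrite (negPf (lend_ntr i)).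
(* Edges raise the height; this clears the entries above the diagonal of the transit block and
   leaves only the new edge on it. *)
have no_edge u v : (h v <= h u)%N ->
    \sum_(e | (e \in live L T) && ((src e == u) && (dst e == v))) w e = 0.
  move=> le; apply: big_pred0 => e; apply/negP=> /and3P[_ /eqP eu /eqP ev].
  by have := hlt e; rewrite eu ev ltnNge le.
apply: pivots_elim => [i|i j ij|i j].
- rewrite M'E !vertl /resolution_entry no_edge // eqxx !in_setU tau_transit
  !orbT.
  by rewrite expr1 add0r.
- rewrite M'E !vertl /resolution_entry no_edge ?tau_sorted // add0r.
  by case: eqP ij => // /tau_inj ->; rewrite ltnn.
under eq_bigr do rewrite M'E !vertl.
rewrite M'E vertl vertr sum_tau resolution_entry_sum ?tau_transit ?imset_f //.
by rewrite in_setU tau_transit orbT.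
Qed.

End Assembly.

Lemma kasteleyn_signs_edgeless (R : comPzRingType) (G : embedded_digraph)
    (w : edge G -> R) (L T : {set vertex G})
    (sgn : bg_edge (resolution w L T) -> bool) :
  #|edge G| = 0 -> kasteleyn_signs sgn.
Proof.
move=> E0; have noE (e : edge G) : False.
  by have := max_card (pred1 e); rewrite E0 card1.
case=> [[a|p] b] /=; first by case: (noE (sval a)).
by rewrite /new_face; case: pickP => [x|//]; case: (noE x.1).
Qed.

Lemma by_deleted_pivots_operations (R : comPzRingType) m n (V V' : 'M[R]_(m, n))
    p q (M : 'M[R]_(p, q)) :
  by_matrix_operations V V' -> by_deleted_pivots V' M ->
    by_matrix_operations V M.
Proof.
move=> VV'; elim=> {p q M} // p q M M' i j piv _ IH.
exact: mo_pivot piv IH.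
Qed.

Lemma gessel_viennot_all_kept (R : comPzRingType) (G : embedded_digraph)
    (w : edge G -> R) (n : nat) (lend rend : 'I_n -> vertex G) :
  acyclic G ->
  (forall e, kept [set lend i | i : 'I_n] [set rend j | j : 'I_n] e) ->
  gessel_viennot w lend rend = kept_matrix w lend rend.
Proof.
move=> Gacyc allk; rewrite gessel_viennotE // /kept_matrix /path_sums.
have -> // : adj w (kept [set lend i | i : 'I_n] [set rend j | j : 'I_n]) =
  adj w predT.
by apply/matrixP=> i j; rewrite !mxE; apply: eq_bigl => e; rewrite allk.
Qed.

Theorem corollary7 (R : comPzRingType) (G : embedded_digraph) (w : edge G -> R)
    (n : nat) (lend rend : 'I_n -> vertex G) :
  connected_graph G ->
  planar_embedding G ->
  acyclic G ->
  injective lend ->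
  injective rend ->
  (forall i, on_outside (lend i)) ->
  (forall j, on_outside (rend j)) ->
  segregated lend rend ->
  let V := gessel_viennot w lend rend in
  let G' := transit_free_resolution w lend rend in
  ((forall v : vertex G, is_source v <-> exists i, v = lend i) ->
   (forall v : vertex G, is_sink v <-> exists j, v = rend j) ->
   exists M : 'M[R]_(#|bg_black G'|, #|bg_white G'|),
     kasteleyn_percus M /\ by_deleted_pivots V M)
  /\
  (~ (forall i, is_source (lend i)) \/ ~ (forall j, is_sink (rend j)) ->
   exists M : 'M[R]_(#|bg_black G'|, #|bg_white G'|),
     kasteleyn_percus M /\ by_matrix_operations V M).
Proof.
move=> Gconn Gplanar Gacyc lend_inj rend_inj _ _ [s [k [sw sL sT]]] V G'.
have signs : @kasteleyn_signs _ G' (@resolution_sign _ _ _ _ w).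
  case: sw => [[d dout sE]|[E0 _]]; last exact: kasteleyn_signs_edgeless.
  subst s; apply: (resolution_sign_kasteleyn Gconn Gplanar Gacyc dout (k := k)).
    by move=> _ /imsetP[i _ ->].
  by move=> _ /imsetP[j _ ->].
have [M [[rho [gam [rho_bij gam_bij ME]]] pivots]] :=
  resolution_pivots w Gacyc lend_inj rend_inj.
have KP : @kasteleyn_percus _ G' M by exists rho, gam,
  (@resolution_sign _ _ _ _ w).
split=> [sources sinks|_]; exists M; split=> //.
  (* No edge enters a source or leaves a sink, so every edge is kept and the pivots already end at
     [V]. *)
  rewrite /V gessel_viennot_all_kept // => e; apply/andP; split.
    apply/imsetP=> -[i _ ei]; have /sources/forallP/(_ e) : exists i, dst e =
      lend i by exists i.
    by rewrite eqxx.
  apply/imsetP=> -[j _ ej]; have /sinks/forallP/(_ e) : exists j, src e =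
    rend j by exists j.
  by rewrite eqxx.
have [A [B [A' [B' [AA' A'A BB' B'B VE]]]]] :=
  gessel_viennot_kept w Gacyc lend_inj rend_inj.
(* The pivots end at [kept_matrix]; one row and one column operation supply the two factors. *)
apply: by_deleted_pivots_operations pivots.
apply: (mo_row AA' A'A); apply: (mo_col BB' B'B).
by rewrite -VE; apply: mo_done.
Qed.
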